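(* Let $\mathbb{K}$ be a field. For all objects $X$ and $Y$ of $\mathsf{Ch}_{\mathbb{K}}^{(\mathbb{R},\leq)}$ one has $$d_{\mathrm{HC}}(X,Y)=d_{\mathrm{IHC}}(X,Y)=d_{\mathrm{HI}}(X,Y)=d_{\mathrm{CohI}}(X,Y).$$
   Context: $\mathsf{Ch}_{\mathbb{K}}$ is the category of (not necessarily bounded) cochain complexes over $\mathbb{K}$, a cofibrantly generated model category whose weak equivalences are the quasi-isomorphisms. $(\mathbb{R},\leq)$ is the poset of real numbers viewed as a category, and for a category $\mathcal{C}$, $\mathcal{C}^{(\mathbb{R},\leq)}$ is the functor category. $\mathsf{Ch}_{\mathbb{K}}^{(\mathbb{R},\leq)}$ carries the projective model structure (weak equivalences are pointwise). Interleavings: for $F\in\mathcal{C}^{(\mathbb{R},\leq)}$ and real $\varepsilon\ge 0$ let $F^{\varepsilon}(a)=F(a+\varepsilon)$. Objects $F,G$ of $\mathcal{C}^{(\mathbb{R},\leq)}$ are $\varepsilon$-interleaved if there are natural transformations $\varphi:F\to G^{\varepsilon}$, $\psi:G\to F^{\varepsilon}$ such that $\psi^{\varepsilon}\circ\varphi:F\to F^{2\varepsilon}$ and $\varphi^{\varepsilon}\circ\psi:G\to G^{2\varepsilon}$ are the natural transformations given by the structure maps of $F$ and $G$. The interleaving distance is $d_{\mathrm I}(F,G)=\inf(\{\varepsilon\ge0\mid F,G\text{ are }\varepsilon\text{-interleaved}\}\cup\{\infty\})$. For $X,Y\in\mathsf{Ch}_{\mathbb{K}}^{(\mathbb{R},\leq)}$,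 write $X\simeq X'$ if there is a zigzag of weak equivalences connecting them. (1) $X,Y$ are $\varepsilon$-homotopy interleaved if there are $X'\simeq X$ and $Y'\simeq Y$ such that $X',Y'$ are $\varepsilon$-interleaved in $\mathsf{Ch}_{\mathbb{K}}^{(\mathbb{R},\leq)}$. (2) $X,Y$ are $\varepsilon$-interleaved in the homotopy category if there are morphisms $X\to Y^{\varepsilon}$, $Y\to X^{\varepsilon}$ in $\mathrm{Ho}(\mathsf{Ch}_{\mathbb{K}}^{(\mathbb{R},\leq)})$ satisfying the interleaving identities there (the shift functor preserves weak equivalences, hence descends to the homotopy category). (3) $X,Y$ are $\varepsilon$-homotopy commutative interleaved if their images in $\mathrm{Ho}(\mathsf{Ch}_{\mathbb{K}})^{(\mathbb{R},\leq)}$ are $\varepsilon$-interleaved. $d_{\mathrm{HI}}$, $d_{\mathrm{IHC}}$, $d_{\mathrm{HC}}$ denote the infimum of the $\varepsilon\ge 0$ (together with $\infty$) for which (1), (2), (3) hold, respectively. The cohomology interleaving distance is $d_{\mathrm{CohI}}(X,Y)=\sup\{d_{\mathrm I}(H^k(X),H^k(Y))\mid k\in\mathbb{Z}\}$, where $H^k(X)$ is the persistence vector space $r\mapsto H^k(X(r))$. *)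

(* Defs.v *)
From HB Require Import structures.
From mathcomp Require Import all_boot all_order all_algebra.
From mathcomp Require Import generic_quotient ring_quotient interval_inference.
From mathcomp Require Import boolp classical_sets constructive_ereal reals ereal.

Set Implicit Arguments.
Unset Strict Implicit.
Unset Printing Implicit Defensive.
Import Order.TTheory GRing.Theory Num.Theory.
Local Open Scope ring_scope.

Record category := Category {
  obj :> Type;
  hom : obj -> obj -> Type;
  idc : forall X, hom X X;
  comp : forall X Y Z, hom Y Z -> hom X Y -> hom X Z;
  comp1c : forall X Y (f : hom X Y), comp (idc Y) f = f;
  compc1 : forall X Y (f : hom X Y), comp f (idc X) = f;
  compA : forall X Y Z T (h : hom Z T) (g : hom Y Z) (f : hom X Y),
    comp h (comp g f) = comp (comp h g) f }.
Arguments hom {c}.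
Arguments idc {c}.
Arguments comp {c X Y Z}.

Record functor (C D : category) := Functor {
  fobj :> C -> D;
  fmap : forall X Y, hom X Y -> hom (fobj X) (fobj Y);
  fmap1 : forall X, fmap (idc X) = idc (fobj X);
  fmapM : forall X Y Z (g : hom Y Z) (f : hom X Y),
    fmap (comp g f) = comp (fmap g) (fmap f) }.
Arguments fmap {C D} _ {X Y} _.

Record nattrans (C D : category) (F G : functor C D) := NatTrans {
  ntapp :> forall X : C, hom (F X) (G X);
  ntnat : forall X Y (f : hom X Y),
    comp (ntapp Y) (fmap F f) = comp (fmap G f) (ntapp X) }.

Lemma nattrans_ext (C D : category) (F G : functor C D) (a b : nattrans F G) :
  (forall X, a X = b X) -> a = b.
Proof.
case: a b => [a an] [b bn] /= ab.
have {}ab : a = b by apply: functional_extensionality_dep.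
by case: b / ab bn => bn; congr NatTrans; exact: Prop_irrelevance.
Qed.

Section FunctorCategory.
Variables C D : category.

Definition nt_id (F : functor C D) : nattrans F F.
Proof. by exists (fun X => idc (F X)) => X Y f; rewrite comp1c compc1. Defined.

Definition nt_comp (F G H : functor C D) (b : nattrans G H) (a : nattrans F G) :
  nattrans F H.
Proof.
exists (fun X => comp (b X) (a X)) => X Y f.
by rewrite -compA ntnat compA ntnat compA.
Defined.

Definition functor_category : category.
Proof.
exists (functor C D) (@nattrans C D) nt_id nt_comp.
- by move=> F G a; apply: nattrans_ext => X /=; rewrite comp1c.
- by move=> F G a; apply: nattrans_ext => X /=; rewrite compc1.
- by move=> F G H K c b a; apply: nattrans_ext => X /=; rewrite compA.
Defined.

End FunctorCategory.

Definition functor_comp (C D E : category) (G : functor D E) (F : functor C D) :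
  functor C E.
Proof.
exists (fun X => G (F X)) (fun X Y f => fmap G (fmap F f)).
- by move=> X; rewrite !fmap1.
- by move=> X Y Z g f; rewrite !fmapM.
Defined.

Definition precompose (C D E : category) (T : functor C D) :
  functor (functor_category D E) (functor_category C E).
Proof.
exists (fun F : functor_category D E =>
          functor_comp F T : functor_category C E)
       (fun F G (a : nattrans F G) =>
          @NatTrans _ _ (functor_comp F T) (functor_comp G T)
            (fun X => a (T X)) (fun X Y f => ntnat a (fmap T f))).
- by move=> F; apply: nattrans_ext.
- by move=> F G H b a; apply: nattrans_ext.
Defined.

(* The localization C[W^-1], presented by generators (the morphisms of C and
   formal inverses of those in W) and relations. The homotopy category of a model
   category is its localization at the weak equivalences W; the fibrations and
   cofibrations play no role in its definition. *)
Section Localization.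
Variables (C : category) (W : forall X Y : C, hom X Y -> Prop).

Inductive word : C -> C -> Type :=
| wmor X Y (f : hom X Y) : word X Y
| winv X Y (f : hom X Y) (Wf : W f) : word Y X
| wcomp X Y Z (v : word Y Z) (u : word X Y) : word X Z.

Inductive weq : forall X Y : C, word X Y -> word X Y -> Prop :=
| weq_refl X Y (u : word X Y) : weq u u
| weq_sym X Y (u v : word X Y) : weq u v -> weq v u
| weq_trans X Y (u v w : word X Y) : weq u v -> weq v w -> weq u w
| weq_comp X Y Z (v v' : word Y Z) (u u' : word X Y) :
    weq v v' -> weq u u' -> weq (wcomp v u) (wcomp v' u')
| weq_assoc X Y Z T (w : word Z T) (v : word Y Z) (u : word X Y) :
    weq (wcomp w (wcomp v u)) (wcomp (wcomp w v) u)
| weq_idl X Y (u : word X Y) : weq (wcomp (wmor (idc Y)) u) u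
| weq_idr X Y (u : word X Y) : weq (wcomp u (wmor (idc X))) u
| weq_mor X Y Z (g : hom Y Z) (f : hom X Y) :
    weq (wmor (comp g f)) (wcomp (wmor g) (wmor f))
| weq_invl X Y (f : hom X Y) (Wf : W f) :
    weq (wcomp (winv Wf) (wmor f)) (wmor (idc X))
| weq_invr X Y (f : hom X Y) (Wf : W f) :
    weq (wcomp (wmor f) (winv Wf)) (wmor (idc Y)).

(* Not {eq_quot _}: that quotient needs a choiceType, whose universe has to stay
   below that of the objects of C when C is built from vector spaces. *)
Definition ho_hom (X Y : C) :=
  {P : word X Y -> Prop | exists u, P = weq u}.

Definition ho_class X Y (u : word X Y) : ho_hom X Y :=
  exist _ (weq u) (ex_intro _ u erefl).

Definition ho_repr X Y (p : ho_hom X Y) : word X Y := sval (cid (svalP p)).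

Lemma ho_reprK X Y (p : ho_hom X Y) : ho_class (ho_repr p) = p.
Proof.
rewrite /ho_repr; case: cid => u /=; case: p => P Pex /= Pu; subst P.
by congr exist; exact: Prop_irrelevance.
Qed.

Lemma ho_classP X Y (u v : word X Y) : ho_class u = ho_class v <-> weq u v.
Proof.
split=> [/(congr1 sval) /= uv|uv]; first by rewrite uv; exact: weq_refl.
have E : weq u = weq v.
  apply/funext => w; apply/propext; split=> h.
    exact: weq_trans (weq_sym uv) h.
  exact: weq_trans uv h.
rewrite /ho_class; move: (ex_intro _ u _) (ex_intro _ v _).
by rewrite /= E => p q; congr exist; exact: Prop_irrelevance.
Qed.

Lemma ho_reprP X Y (u : word X Y) : weq (ho_repr (ho_class u)) u.
Proof. by apply/ho_classP; rewrite ho_reprK. Qed.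

Definition Ho : category.
Proof.
exists C ho_hom (fun X => ho_class (wmor (idc X)))
  (fun X Y Z g f => ho_class (wcomp (ho_repr g) (ho_repr f))).
- move=> X Y f; rewrite -[RHS]ho_reprK; apply/ho_classP.
  by apply: weq_trans (weq_idl _); apply: weq_comp (weq_refl _); exact: ho_reprP.
- move=> X Y f; rewrite -[RHS]ho_reprK; apply/ho_classP.
  by apply: weq_trans (weq_idr _); apply: weq_comp (weq_refl _) _; exact: ho_reprP.
- move=> X Y Z T h g f; apply/ho_classP.
  apply: weq_trans (weq_comp (weq_refl _) (ho_reprP _)) _.
  apply: weq_trans (weq_assoc _ _ _) _.
  exact: weq_comp (weq_sym (ho_reprP _)) (weq_refl _).
Defined.

Definition to_ho : functor C Ho.
Proof.
refine (@Functor C Ho (fun X => X) (fun X Y f => ho_class (wmor f)) _ _).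
- by [].
- move=> X Y Z g f; apply/ho_classP; apply: weq_trans (weq_mor _ _) _.
  by apply: weq_comp; apply: weq_sym; exact: ho_reprP.
Defined.

Inductive weakly_equivalent : C -> C -> Prop :=
| we_refl X : weakly_equivalent X X
| we_fwd X Y Z (f : hom X Y) :
    W f -> weakly_equivalent Y Z -> weakly_equivalent X Z
| we_bwd X Y Z (f : hom Y X) :
    W f -> weakly_equivalent Y Z -> weakly_equivalent X Z.

End Localization.

Section HoFunctor.
Variables (C D : category).
Variables (V : forall X Y : C, hom X Y -> Prop).
Variables (W : forall X Y : D, hom X Y -> Prop).
Variables (F : functor C D).
Hypothesis FVW : forall X Y (f : hom X Y), V f -> W (fmap F f).

Fixpoint word_map (X Y : C) (u : word V X Y) : word W (F X) (F Y) :=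
  match u with
  | wmor _ _ f => wmor W (fmap F f)
  | winv _ _ f Vf => winv (FVW Vf)
  | wcomp _ _ _ v u => wcomp (word_map v) (word_map u)
  end.

Lemma word_map_weq X Y (u v : word V X Y) :
  weq u v -> weq (word_map u) (word_map v).
Proof.
elim=> {X Y u v} /=.
- by move=> *; exact: weq_refl.
- by move=> *; exact: weq_sym.
- by move=> X Y u v w _ uv _ vw; exact: weq_trans uv vw.
- by move=> *; exact: weq_comp.
- by move=> *; exact: weq_assoc.
- by move=> *; rewrite fmap1; exact: weq_idl.
- by move=> *; rewrite fmap1; exact: weq_idr.
- by move=> *; rewrite fmapM; exact: weq_mor.
- by move=> *; rewrite fmap1; exact: weq_invl.
- by move=> *; rewrite fmap1; exact: weq_invr.
Qed.

Definition ho_functor : functor (Ho V) (Ho W).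
Proof.
refine (@Functor (Ho V) (Ho W) F
          (fun X Y f => ho_class (word_map (ho_repr f))) _ _).
- move=> X; apply/ho_classP; rewrite -fmap1.
  exact: word_map_weq (ho_reprP _).
- move=> X Y Z g f; apply/ho_classP.
  apply: weq_trans (word_map_weq (ho_reprP _)) _.
  by apply: weq_comp; apply: weq_sym; exact: ho_reprP.
Defined.

End HoFunctor.

Section Interleaving.

(* For S the shift functor by e and s X : X -> S (S X) the structure map, this is the
   notion of e-interleaving. *)
Definition interleaved_by (D : category) (S : functor D D)
    (s : forall X : D, hom X (S (S X))) (X Y : D) : Prop :=
  exists (phi : hom X (S Y)) (psi : hom Y (S X)),
    comp (fmap S psi) phi = s X /\ comp (fmap S phi) psi = s Y.

Variables (R : realType) (C : category).

Definition real_poset : category.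
Proof.
exists R (fun a b : R => a <= b) (fun a => lexx a)
       (fun a b c (bc : b <= c) (ab : a <= b) => le_trans ab bc).
all: by move=> *; exact: Prop_irrelevance.
Defined.

Definition translation (e : R) : functor real_poset real_poset.
Proof.
refine (@Functor real_poset real_poset (fun a : R => a + e)
          (fun (a b : R) (ab : a <= b) => lerD ab (lexx e)) _ _).
all: by move=> *; exact: (@Prop_irrelevance (_ <= _ :> R)).
Defined.

Definition pers : category := functor_category real_poset C.

Definition shift (e : R) : functor pers pers := precompose C (translation e).

Lemma shift_unit_subproof (e : {nonneg R}) (a : R) : a <= a + e%:num + e%:num.
Proof. by rewrite -addrA lerDl addr_ge0. Qed.

(* F^(2e) is represented as (F^e)^e, since a + e + e and a + 2 * e are not
   convertible. *)
Definition shift_unit (e : {nonneg R}) (F : pers) :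
  hom F (shift e%:num (shift e%:num F)).
Proof.
exists (fun a : real_poset =>
  @fmap _ _ F a (a + e%:num + e%:num) (shift_unit_subproof e a)).
move=> a b ab; rewrite /= -!fmapM; congr (fmap F _).
exact: (@Prop_irrelevance (_ <= _ :> R)).
Defined.

Definition interleaved (e : {nonneg R}) (F G : pers) : Prop :=
  interleaved_by (shift_unit e) F G.

Local Open Scope classical_set_scope.

Definition inf_dist (P : {nonneg R} -> Prop) : \bar R :=
  ereal_inf ([set (e%:num)%:E | e in [set e | P e]] `|` [set +oo%E]).

Definition dI (F G : pers) : \bar R := inf_dist (fun e => interleaved e F G).

End Interleaving.
Arguments real_poset : clear implicits.
Arguments pers : clear implicits.

Section VectorSpaces.
Variable K : fieldType.

Lemma linear_ext (V W : lmodType K) (f g : {linear V -> W}) : f =1 g -> f = g.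
Proof.
case: f g => f fc [g gc] /= /funext fg; case: g / fg gc => gc.
congr GRing.Linear.Pack.
case: fc gc => [[a] [b]] [[c] [d]].
by congr GRing.Linear.Class; f_equal; exact: Prop_irrelevance.
Qed.

Definition vect : category.
Proof.
refine (@Category (lmodType K) (fun V W => {linear V -> W}) (fun V => idfun)
          (fun U V W (g : {linear V -> W}) (f : {linear U -> V}) => g \o f)
          _ _ _).
all: by move=> *; exact: linear_ext.
Defined.

End VectorSpaces.

Section QuotientModule.
Variables (K : fieldType) (V : lmodType K).
Variables (U : V -> bool) (Umod : submod_closed U).
Local Open Scope quotient_scope.

Definition submod_zmod : zmodClosed V :=
  HB.pack_for (zmodClosed V) U
    (GRing.isZmodClosed.Build V U (GRing.submod_closedB Umod)).

Definition quot_lmod := Quotient.quot submod_zmod.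
HB.instance Definition _ := GRing.Zmodule.on quot_lmod.

Definition quot_pi (v : V) : quot_lmod := \pi_(Quotient.quot submod_zmod) v.

Lemma quot_piP (v w : V) : quot_pi v = quot_pi w <-> U (v - w).
Proof.
rewrite -[U _]/(v - w \in submod_zmod) Quotient.idealrBE.
by split=> [/eqP|/eqP].
Qed.

Lemma quot_piD (v w : V) : quot_pi (v + w) = quot_pi v + quot_pi w.
Proof. by rewrite /quot_pi raddfD. Qed.

Lemma quot_piK (q : quot_lmod) : quot_pi (repr q) = q.
Proof. exact: reprK. Qed.

Definition quot_scale (a : K) (q : quot_lmod) : quot_lmod := quot_pi (a *: repr q).

Lemma quot_scaleE a (v : V) : quot_scale a (quot_pi v) = quot_pi (a *: v).
Proof.
have /quot_piP Uv := quot_piK (quot_pi v); apply/quot_piP.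
by rewrite -scalerBr -[_ *: _]addr0; apply: Umod.2 => //; exact: Umod.1.
Qed.

Lemma quot_scaleA a b q : quot_scale a (quot_scale b q) = quot_scale (a * b) q.
Proof. by rewrite -[q]quot_piK !quot_scaleE scalerA. Qed.

Lemma quot_scale1 : left_id 1 quot_scale.
Proof. by move=> q; rewrite -[q]quot_piK quot_scaleE scale1r. Qed.

Lemma quot_scaleDr : right_distributive quot_scale +%R.
Proof.
move=> a p q; rewrite -[p]quot_piK -[q]quot_piK -quot_piD !quot_scaleE.
by rewrite -quot_piD scalerDr.
Qed.

Lemma quot_scaleDl q : {morph quot_scale^~ q : a b / a + b}.
Proof.
by move=> a b /=; rewrite -[q]quot_piK !quot_scaleE -quot_piD scalerDl.
Qed.

HB.instance Definition _ := GRing.Zmodule_isLmodule.Build K quot_lmod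
  quot_scaleA quot_scale1 quot_scaleDr quot_scaleDl.

End QuotientModule.

Section CochainComplexes.
Variable K : fieldType.

(* The differential out of degree i lands in degree i + 1; allowing any j with
   i + 1 = j avoids transports along equalities such as k - 1 + 1 = k. *)
Record cochain := Cochain {
  cobj :> int -> lmodType K;
  cdiff : forall i j : int, i + 1 = j -> {linear cobj i -> cobj j};
  cdiffK : forall (i j k : int) (ij : i + 1 = j) (jk : j + 1 = k) (x : cobj i),
    cdiff jk (cdiff ij x) = 0 }.
Arguments cdiff c {i j}.

Record cochain_map (X Y : cochain) := CochainMap {
  cmap :> forall i : int, {linear X i -> Y i};
  cmap_diff : forall (i j : int) (ij : i + 1 = j) (x : X i),
    cmap j (cdiff X ij x) = cdiff Y ij (cmap i x) }.

Lemma cochain_map_ext (X Y : cochain) (f g : cochain_map X Y) :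
  (forall i, f i =1 g i) -> f = g.
Proof.
case: f g => [f fd] [g gd] /= fg.
have {}fg : f = g.
  by apply: functional_extensionality_dep => i; exact: linear_ext (fg i).
by case: g / fg gd => gd; rewrite (Prop_irrelevance fd gd).
Qed.

Definition cochain_id (X : cochain) : cochain_map X X.
Proof. by exists (fun i => idfun). Defined.

Definition cochain_comp (X Y Z : cochain)
  (g : cochain_map Y Z) (f : cochain_map X Y) : cochain_map X Z.
Proof. by exists (fun i => g i \o f i) => i j ij x /=; rewrite !cmap_diff. Defined.

Definition Ch : category.
Proof.
exists cochain cochain_map cochain_id cochain_comp.
all: by move=> *; exact: cochain_map_ext.
Defined.

Section Cohomology.
Variables (X : cochain) (k : int).

Definition is_cocycle : pred (X k) := fun x => cdiff X (erefl (k + 1)) x == 0.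

Lemma is_cocycle_submod : submod_closed is_cocycle.
Proof.
split=> [|a u v]; rewrite !unfold_in /is_cocycle ?linear0 // => /eqP du /eqP dv.
by rewrite linearP du dv scaler0 addr0.
Qed.
HB.instance Definition _ :=
  GRing.isSubmodClosed.Build K (X k) is_cocycle
    (GRing.submod_closed_semi is_cocycle_submod).

Definition cocycle := {x : X k | is_cocycle x}.
HB.instance Definition _ := SubChoice.on cocycle.
HB.instance Definition _ := [SubChoice_isSubLmodule of cocycle by <:].

Definition is_coboundary : pred cocycle :=
  fun z => `[< exists w : X (k - 1), cdiff X (subrK 1 k) w = val z >].

Lemma is_coboundary_submod : submod_closed is_coboundary.
Proof.
split=> [|a u v]; rewrite !unfold_in.
  by apply/asboolP; exists 0; rewrite !linear0.
move=> /asboolP[x dx] /asboolP[y dy]; apply/asboolP; exists (a *: x + y).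
by rewrite linearP dx dy linearP.
Qed.

Definition cohomology : lmodType K := quot_lmod is_coboundary_submod.

End Cohomology.

Section CohomologyMap.
Variables (X Y : cochain) (f : cochain_map X Y) (k : int).

Lemma cocycle_map_subproof (z : cocycle X k) : is_cocycle (f k (val z)).
Proof.
by rewrite /is_cocycle -cmap_diff (eqP (valP z)) linear0.
Qed.

Definition cocycle_map (z : cocycle X k) : cocycle Y k :=
  exist _ (f k (val z)) (cocycle_map_subproof z).

Definition cohomology_fun (c : cohomology X k) : cohomology Y k :=
  quot_pi (@is_coboundary_submod Y k) (cocycle_map (repr c)).

Lemma cohomology_funE (z : cocycle X k) :
  cohomology_fun (quot_pi (@is_coboundary_submod X k) z) =
  quot_pi (@is_coboundary_submod Y k) (cocycle_map z).
Proof.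
apply/quot_piP.
have /quot_piP/asboolP[w dw] := quot_piK (quot_pi (@is_coboundary_submod X k) z).
by apply/asboolP; exists (f (k - 1) w); rewrite -cmap_diff dw !raddfB.
Qed.

Lemma cohomology_fun_linear : linear cohomology_fun.
Proof.
move=> a p q; rewrite -[p]quot_piK -[q]quot_piK.
rewrite -[a *: _]/(quot_scale _ _) quot_scaleE -quot_piD !cohomology_funE.
rewrite -[a *: _]/(quot_scale _ _) quot_scaleE -quot_piD.
by congr quot_pi; apply: val_inj; rewrite /= !linearP.
Qed.

HB.instance Definition _ := GRing.isLinear.Build K (cohomology X k)
  (cohomology Y k) *:%R cohomology_fun cohomology_fun_linear.

Definition cohomology_map : {linear cohomology X k -> cohomology Y k} :=
  cohomology_fun.

End CohomologyMap.

Definition cohomology_functor (k : int) : functor Ch (vect K).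
Proof.
exists (fun X : Ch => cohomology X k : vect K)
       (fun X Y (f : cochain_map X Y) => cohomology_map f k).
- move=> X; apply: linear_ext => c; rewrite -[c]quot_piK /=.
  by rewrite cohomology_funE; congr quot_pi; apply: val_inj.
- move=> X Y Z g f; apply: linear_ext => c; rewrite -[c]quot_piK /=.
  by rewrite !cohomology_funE; congr quot_pi; apply: val_inj.
Defined.

Definition quasi_iso (X Y : Ch) (f : hom X Y) : Prop :=
  forall k : int, bijective (cohomology_map f k).

End CochainComplexes.

Section Distances.
Variables (K : fieldType) (R : realType).

Definition pers_quasi_iso (X Y : pers R (Ch K)) (f : hom X Y) : Prop :=
  forall r : R, quasi_iso (ntapp f r).

Definition HoCh : category := Ho (@quasi_iso K).
Definition HoPersCh : category := Ho pers_quasi_iso.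

Lemma shift_quasi_iso (e : R) (X Y : pers R (Ch K)) (f : hom X Y) :
  pers_quasi_iso f -> pers_quasi_iso (fmap (shift (Ch K) e) f).
Proof. by move=> qf r; exact: qf. Qed.

Definition ho_shift (e : R) : functor HoPersCh HoPersCh :=
  ho_functor (@shift_quasi_iso e).

Definition homotopy_interleaved (e : {nonneg R}) (X Y : pers R (Ch K)) : Prop :=
  exists X' Y' : pers R (Ch K),
    [/\ weakly_equivalent pers_quasi_iso X X',
        weakly_equivalent pers_quasi_iso Y Y' &
        interleaved e X' Y'].

Definition ho_interleaved (e : {nonneg R}) (X Y : pers R (Ch K)) : Prop :=
  @interleaved_by HoPersCh (ho_shift e%:num)
    (fun Z => fmap (to_ho pers_quasi_iso) (shift_unit e Z)) X Y.

Definition homotopy_commutative_interleaved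
    (e : {nonneg R}) (X Y : pers R (Ch K)) : Prop :=
  @interleaved R HoCh e (functor_comp (to_ho (@quasi_iso K)) X)
                        (functor_comp (to_ho (@quasi_iso K)) Y).

Definition dHI (X Y : pers R (Ch K)) : \bar R :=
  inf_dist (fun e => homotopy_interleaved e X Y).
Definition dIHC (X Y : pers R (Ch K)) : \bar R :=
  inf_dist (fun e => ho_interleaved e X Y).
Definition dHC (X Y : pers R (Ch K)) : \bar R :=
  inf_dist (fun e => homotopy_commutative_interleaved e X Y).

Local Open Scope classical_set_scope.

Definition dCohI (X Y : pers R (Ch K)) : \bar R :=
  ereal_sup (range (fun k : int =>
    dI (functor_comp (cohomology_functor K k) X)
       (functor_comp (cohomology_functor K k) Y))).

End Distances.

(* Main.v *)
From HB Require Import structures.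
From mathcomp Require Import all_boot all_order all_algebra.
From mathcomp Require Import interval_inference boolp classical_sets.
From mathcomp Require Import constructive_ereal reals ereal zify lra.
Require Import Defs.

(* For every e, homotopy interleavings give interleavings in the homotopy category,
   these give homotopy commutative ones by evaluating at each real, and these give
   interleavings of cohomology; so d_CohI <= d_HC <= d_IHC <= d_HI.

   Conversely, over the poset of integers a persistent complex M over a field is
   formal: with i a linear section of the cocycles over cohomology and h a homotopy
   measuring the failure of i to be natural, a homotopy limit model of the homotopy
   fibre product of M and H(M) maps to both by trivial fibrations. Rounding the reals
   up to the grid d Z costs a d-interleaving, so X is linked to the rounding of H(X)
   by a d-interleaving and a span of trivial fibrations. All objects being fibrant,
   strict interleavings can be pulled back along trivial fibrations; hence
   interleavings up to such spans compose additively, and interleavings of all H^k by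
   e produce a homotopy interleaving by e + 4d, for every d > 0. *)

Set Implicit Arguments.
Unset Strict Implicit.
Unset Printing Implicit Defensive.
Import Order.TTheory GRing.Theory Num.Theory.
Local Open Scope ring_scope.

(** * Linear algebra *)

(** Over a field, naturality up to homotopy is easy: sections of the cocycles exist degree by
    degree, and their failure to be natural is a coboundary. The obstacle is to turn this into
    strict maps of diagrams. Over the integers every comparison is a composite of unit steps, so one
    homotopy for each unit step suffices, with no coherence conditions between them; the reals have
    no unit steps, hence the rounding. The model at n records comparison homotopies at all indices z
    >= n, so that on these components its structure maps are mere restrictions and strictly
    functorial. Lifts along its two projections are built by recursion upwards from z = n: the
    integers have no first index, but the indices seen by the model at n do. The error made by
    rounding is harmless because the distances are infima; no interleaving at the infimum itself is
    produced. *)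

Section LinearAlgebra.
Variable K : fieldType.
Local Open Scope classical_set_scope.

Definition mk_linear (U V : lmodType K) (f : U -> V) (fl : linear f) :
  {linear U -> V} :=
  HB.pack f (GRing.isLinear.Build K U V *:%R f fl).

(** Vector spaces are projective. Zorn's lemma is applied to the graphs of partial linear lifts. The
    same statement yields linear sections of quotient maps and linear choices of bounding
    cochains. *)
Lemma linear_lift (U V W : lmodType K) (s : {linear U -> W}) (g : {linear V -> W}) :
  (forall u, exists v, g v = s u) -> exists l : {linear U -> V}, forall u, g (l u) = s u.
Proof.
move=> sg.
pose P (A : set (U * V)) :=
  [/\ forall a p q, A p -> A q -> A (a *: p + q),
      forall v, A (0, v) -> v = 0 & forall p, A p -> g p.2 = s p.1].
have [F FP tot|A [[Alin A0 Ags] Amax]] := @Zorn_bigcup _ P.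
  split=> [a p q [B FB Bp] [C FC Cq]|v [B /FP[_ B0 _]]|p [B /FP[_ _]]]; last 2 first.
  - exact: B0.
  - exact.
  have [BC|CB] := tot _ _ FB FC.
    by exists C => //; have [Clin _ _] := FP _ FC; apply: Clin => //; exact: BC.
  by exists B => //; have [Blin _ _] := FP _ FB; apply: Blin => //; exact: CB.
(* [P] admits the empty set, which is the union of the empty chain; that the maximal graph is
   inhabited follows by comparing it with [[set 0]]. *)
have [p0 Ap0] : exists p, A p.
  apply/not_existsP => An; apply: (Amax [set 0]).
    split=> [|/(_ 0 erefl)]; last exact: An.
    by move=> p /An.
  split=> [a p q -> ->|v [->//]|p ->]; first by rewrite scaler0 addr0.
  by rewrite !linear0.
have A00 : A 0 by have := Alin (-1) _ _ Ap0 Ap0; rewrite scaleN1r addNr.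
have Afun u v w : A (u, v) -> A (u, w) -> v = w.
  move=> uv uw; apply/eqP; rewrite eq_sym -subr_eq0; apply/eqP/A0.
  have := Alin (-1) _ _ uv uw; rewrite scaleN1r.
  by rewrite -[- _ + _]/(- u + u, - v + w) addNr addrC.
have Adom u : exists v, A (u, v).
  apply/not_existsP => Au; have [v0 gv0] := sg u.
  (* Adjoin the line through [(u, v0)]. Single-valuedness could only fail if a nonzero multiple of
     [u] were in the domain of [A], contrary to [Au]. *)
  pose B := [set p | exists b q, A q /\ p = b *: (u, v0) + q].
  apply: (Amax B).
    split=> [p Ap|/(_ (u, v0))]; first by exists 0, p; rewrite scale0r add0r.
    by move=> BA; apply/(Au v0)/BA; exists 1, 0; rewrite scale1r addr0.
  split=> [a _ _ [b [p [Ap ->]]] [c [q [Aq ->]]]|v [b [[u' v'] [Ap [bu ->]]]]|].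
  - exists (a * b + c), (a *: p + q); split; first exact: Alin.
    by rewrite scalerDr scalerA scalerDl !addrA; congr (_ + _); rewrite addrAC.
  - have [b0|b0] := eqVneq b 0.
      move: bu Ap; rewrite b0 !scale0r !add0r => <- /A0 ->.
      by [].
    case: (Au (- b^-1 *: v')).
    have := Alin (- b^-1) _ _ Ap A00; rewrite addr0.
    rewrite -[_ *: _]/(_ *: u', _ *: v') -[u'](addKr (b *: u)) -bu addr0.
    by rewrite scalerN scaleNr opprK scalerA mulVf // scale1r.
  - by move=> _ [b [p [/Ags gp ->]]]; rewrite /= !linearP gv0 gp.
have [l lA] := choice Adom.
have llin : linear l.
  by move=> a u v; apply: Afun (lA _) _; exact: (Alin a _ _ (lA u) (lA v)).
by exists (mk_linear llin) => u; exact: (Ags _ (lA u)).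
Qed.

End LinearAlgebra.

Section DependentProduct.
Variables (K : fieldType) (I : Type) (V : I -> lmodType K).

Definition dprod := forall i, V i.
HB.instance Definition _ := gen_eqMixin dprod.
HB.instance Definition _ := gen_choiceMixin dprod.

Definition dprod_add (f g : dprod) : dprod := fun i => f i + g i.
Definition dprod_opp (f : dprod) : dprod := fun i => - f i.
Definition dprod_scale (a : K) (f : dprod) : dprod := fun i => a *: f i.

Lemma dprod_ext (f g : dprod) : (forall i, f i = g i) -> f = g.
Proof. exact: functional_extensionality_dep. Qed.

Fact dprod_addA : associative dprod_add.
Proof. by move=> f g h; apply: dprod_ext => i; exact: addrA. Qed.
Fact dprod_addC : commutative dprod_add.
Proof. by move=> f g; apply: dprod_ext => i; exact: addrC. Qed.
Fact dprod_add0 : left_id (fun i => 0 : V i) dprod_add.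
Proof. by move=> f; apply: dprod_ext => i; exact: add0r. Qed.
Fact dprod_addN : left_inverse (fun i => 0 : V i) dprod_opp dprod_add.
Proof. by move=> f; apply: dprod_ext => i; exact: addNr. Qed.

HB.instance Definition _ := GRing.isZmodule.Build dprod
  dprod_addA dprod_addC dprod_add0 dprod_addN.

Fact dprod_scaleA a b f : dprod_scale a (dprod_scale b f) = dprod_scale (a * b) f.
Proof. by apply: dprod_ext => i; exact: scalerA. Qed.
Fact dprod_scale1 : left_id 1 dprod_scale.
Proof. by move=> f; apply: dprod_ext => i; exact: scale1r. Qed.
Fact dprod_scaleDr : right_distributive dprod_scale +%R.
Proof. by move=> a f g; apply: dprod_ext => i; exact: scalerDr. Qed.
Fact dprod_scaleDl f : {morph dprod_scale^~ f : a b / a + b}.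
Proof. by move=> a b; apply: dprod_ext => i; exact: scalerDl. Qed.

HB.instance Definition _ := GRing.Zmodule_isLmodule.Build K dprod
  dprod_scaleA dprod_scale1 dprod_scaleDr dprod_scaleDl.

End DependentProduct.

(** * Localizations *)

Section HoTheory.
Variables (C : category) (W : forall X Y : C, hom X Y -> Prop).

Definition ho_inv (X Y : C) (f : hom X Y) (Wf : W f) : @hom (Ho W) Y X :=
  ho_class (winv Wf).

Lemma ho_comp_class (X Y Z : C) (v : word W Y Z) (u : word W X Y) :
  @comp (Ho W) _ _ _ (ho_class v) (ho_class u) = ho_class (wcomp v u).
Proof. by apply/ho_classP; apply: weq_comp; exact: ho_reprP. Qed.

Lemma ho_invl (X Y : C) (f : hom X Y) (Wf : W f) :
  @comp (Ho W) _ _ _ (ho_inv Wf) (fmap (to_ho W) f) = @idc (Ho W) X.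
Proof. by rewrite ho_comp_class; apply/ho_classP; exact: weq_invl. Qed.

Lemma ho_invr (X Y : C) (f : hom X Y) (Wf : W f) :
  @comp (Ho W) _ _ _ (fmap (to_ho W) f) (ho_inv Wf) = @idc (Ho W) Y.
Proof. by rewrite ho_comp_class; apply/ho_classP; exact: weq_invr. Qed.

Lemma ho_ind (P : forall X Y : C, @hom (Ho W) X Y -> Prop) :
  (forall X Y (f : hom X Y), P X Y (fmap (to_ho W) f)) ->
  (forall X Y (f : hom X Y) (Wf : W f), P Y X (ho_inv Wf)) ->
  (forall X Y Z (q : @hom (Ho W) Y Z) (p : @hom (Ho W) X Y),
     P Y Z q -> P X Y p -> P X Z (comp q p)) ->
  forall X Y (p : @hom (Ho W) X Y), P X Y p.
Proof.
move=> Pm Pi Pc X Y p; rewrite -[p]ho_reprK.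
elim: (ho_repr p) => {X Y p} [X Y f|X Y f Wf|X Y Z v Pv u Pu].
- exact: Pm.
- exact: Pi.
- by rewrite -ho_comp_class; exact: Pc.
Qed.

(** Naturality against a formal inverse follows from naturality against the inverted morphism by
    cancelling it on both sides, so only the morphisms of [C] have to be checked. *)
Lemma ho_natural (D : category) (F G : functor (Ho W) D)
    (eta : forall X : C, hom (F X) (G X)) :
  (forall (X Y : C) (f : hom X Y), comp (eta Y) (fmap F (fmap (to_ho W) f)) =
     comp (fmap G (fmap (to_ho W) f)) (eta X)) ->
  forall (X Y : Ho W) (p : hom X Y), comp (eta Y) (fmap F p) = comp (fmap G p) (eta X).
Proof.
move=> nat; apply: ho_ind => [//|X Y f Wf|X Y Z q p IHq IHp]; last first.
  by rewrite !fmapM compA IHq -compA IHp compA.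
rewrite -[LHS]comp1c -(fmap1 G) -(ho_invl Wf) fmapM -compA; congr comp.
by rewrite compA -nat -compA -fmapM ho_invr fmap1 compc1.
Qed.

Section Lift.
Variables (D : category) (F : functor C D).
Variable inv : forall (X Y : C) (f : hom X Y), W f -> hom (F Y) (F X).
Hypothesis invl : forall X Y (f : hom X Y) (Wf : W f),
  comp (inv Wf) (fmap F f) = idc (F X).
Hypothesis invr : forall X Y (f : hom X Y) (Wf : W f),
  comp (fmap F f) (inv Wf) = idc (F Y).

Fixpoint word_eval (X Y : C) (u : word W X Y) : hom (F X) (F Y) :=
  match u with
  | wmor _ _ f => fmap F f
  | winv _ _ f Wf => inv Wf
  | wcomp _ _ _ v u => comp (word_eval v) (word_eval u)
  end.

Lemma word_eval_weq X Y (u v : word W X Y) : weq u v -> word_eval u = word_eval v.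
Proof.
elim=> {X Y u v} //=.
- by move=> X Y u v w _ -> _ ->.
- by move=> X Y Z v v' u u' _ -> _ ->.
- by move=> *; rewrite compA.
- by move=> *; rewrite fmap1 comp1c.
- by move=> *; rewrite fmap1 compc1.
- by move=> *; rewrite fmapM.
- by move=> *; rewrite fmap1.
- by move=> *; rewrite fmap1.
Qed.

(** Universal property of the localization. The inverses are given as data, not as existence
    statements, because words are evaluated by recursion. *)
Definition ho_lift : functor (Ho W) D.
Proof.
refine (@Functor (Ho W) D F (fun X Y p => word_eval (ho_repr p)) _ _).
- by move=> X; rewrite (word_eval_weq (ho_reprP _)) /= fmap1.
- by move=> X Y Z q p; rewrite (word_eval_weq (ho_reprP _)).
Defined.

Lemma ho_liftE (X Y : C) (f : hom X Y) : fmap ho_lift (fmap (to_ho W) f) = fmap F f.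
Proof. by rewrite /= (word_eval_weq (ho_reprP _)). Qed.

End Lift.

Definition isomorphic (D : category) (X Y : D) : Prop :=
  exists (f : hom X Y) (g : hom Y X), comp g f = idc X /\ comp f g = idc Y.

Lemma weakly_equivalent_isomorphic (X Y : C) :
  weakly_equivalent W X Y -> @isomorphic (Ho W) X Y.
Proof.
elim=> {X Y} [X|X Y Z f Wf _ [g [h [gh hg]]]|X Y Z f Wf _ [g [h [gh hg]]]].
- by exists (@idc (Ho W) X), (@idc (Ho W) X); rewrite comp1c.
- exists (comp g (fmap (to_ho W) f)), (@comp (Ho W) _ _ _ (ho_inv Wf) h); split.
    by rewrite -compA (compA h) gh comp1c ho_invl.
  by rewrite -compA (compA (fmap (to_ho W) f)) ho_invr comp1c.
- exists (@comp (Ho W) _ _ _ g (ho_inv Wf)), (comp (fmap (to_ho W) f) h); split.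
    by rewrite -compA (compA h) gh comp1c ho_invr.
  by rewrite -compA (compA (ho_inv Wf)) ho_invl comp1c.
Qed.

End HoTheory.

Lemma ho_functorE (C D : category) (V : forall X Y : C, hom X Y -> Prop)
    (W : forall X Y : D, hom X Y -> Prop) (F : functor C D)
    (FVW : forall X Y (f : hom X Y), V X Y f -> W _ _ (fmap F f))
    (X Y : C) (f : hom X Y) :
  fmap (ho_functor FVW) (fmap (to_ho V) f) = fmap (to_ho W) (fmap F f).
Proof. by apply/ho_classP; exact: word_map_weq (ho_reprP _). Qed.

Section InterleavedBy.
Variables (D : category) (S : functor D D) (s : forall X : D, hom X (S (S X))).
Hypothesis snat : forall (X Y : D) (f : hom X Y),
  comp (s Y) f = comp (fmap S (fmap S f)) (s X).

(** Both morphisms of the interleaving are conjugated. Naturality moves [f] past the unit, where it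
    becomes [S (S f)] and cancels against [S (S f')]. *)
Lemma interleaved_by_iso (X X' Y Y' : D) : isomorphic X X' -> isomorphic Y Y' ->
  interleaved_by s X' Y' -> interleaved_by s X Y.
Proof.
have half (A A' B B' : D) (f : hom A A') (f' : hom A' A) (g : hom B B')
    (g' : hom B' B) (phi : hom A' (S B')) (psi : hom B' (S A')) :
    comp f' f = idc A -> comp g g' = idc B' -> comp (fmap S psi) phi = s A' ->
    comp (fmap S (comp (comp (fmap S f') psi) g)) (comp (comp (fmap S g') phi) f) = s A.
  move=> f'f gg' E.
  rewrite !fmapM -!compA (compA (fmap S g)) -fmapM gg' fmap1 comp1c.
  by rewrite (compA (fmap S psi)) E snat compA -!fmapM f'f !fmap1 comp1c.
move=> [f [f' [f'f ff']]] [g [g' [g'g gg']]] [phi [psi [E1 E2]]].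
exists (comp (comp (fmap S g') phi) f), (comp (comp (fmap S f') psi) g).
by split; exact: half.
Qed.

End InterleavedBy.

(** * Interleavings of persistent objects *)

Section SoftInterleaving.
Variables (R : realType) (C : category).
Implicit Types F G H : pers R C.

Definition pmap F (a b : R) (ab : a <= b) : hom (F a) (F b) :=
  @fmap (real_poset R) C F a b ab.

Lemma pmapM F (a b c : R) (ab : a <= b) (bc : b <= c) (ac : a <= c) :
  comp (pmap F bc) (pmap F ab) = pmap F ac.
Proof. by rewrite /pmap -fmapM; congr (fmap F _); exact: (@Prop_irrelevance (a <= c)). Qed.

Lemma pmap1 F (a : R) (aa : a <= a) : pmap F aa = idc (F a).
Proof. by rewrite -fmap1; congr (fmap F _); exact: (@Prop_irrelevance (a <= a)). Qed.

(* A morphism [F -> G^e] given by all the maps [F a -> G b] with [a + e <= b]: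
   such maps compose without transports along equalities between shifts. *)
Record shift_map (e : R) F G := ShiftMap {
  smap :> forall a b : R, a + e <= b -> hom (F a) (G b);
  smap_nat : forall (a a' b b' : R) (aa' : a <= a') (a'b : a' + e <= b) (bb' : b <= b')
    (ab' : a + e <= b'),
    comp (pmap G bb') (comp (smap a'b) (pmap F aa')) = smap ab' }.

Lemma smap_natl e F G (f : shift_map e F G) (a b b' : R) (ab : a + e <= b)
    (bb' : b <= b') (ab' : a + e <= b') :
  comp (pmap G bb') (f a b ab) = f a b' ab'.
Proof. by rewrite -(smap_nat f (lexx a) ab bb') pmap1 compc1. Qed.

Lemma smap_natr e F G (f : shift_map e F G) (a a' b : R) (aa' : a <= a')
    (a'b : a' + e <= b) (ab : a + e <= b) :
  comp (f a' b a'b) (pmap F aa') = f a b ab.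
Proof. by rewrite -(smap_nat f aa' a'b (lexx b)) pmap1 comp1c. Qed.

Definition inverse_shift_maps e e' F G (f : shift_map e F G) (g : shift_map e' G F) :=
  forall (a b c : R) (ab : a + e <= b) (bc : b + e' <= c) (ac : a <= c),
    comp (g b c bc) (f a b ab) = pmap F ac.

Definition soft_interleaved e F G :=
  exists (f : shift_map e F G) (g : shift_map e G F),
    inverse_shift_maps f g /\ inverse_shift_maps g f.

Lemma pmap_nat F G (f : nattrans F G) (a b : R) (ab : a <= b) :
  comp (f b) (pmap F ab) = comp (pmap G ab) (f a).
Proof. exact: (@ntnat (real_poset R) C F G f a b ab). Qed.

Lemma shift_map_of_nattrans e F G (phi : nattrans F (shift C e G)) :
  exists f : shift_map e F G,
    forall (a b : R) (ab : a + e <= b), f a b ab = comp (pmap G ab) (phi a).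
Proof.
unshelve eexists.
  exists (fun (a b : R) ab => comp (pmap G ab) (phi a)) => a a' b b' aa' a'b bb' ab'.
  rewrite -(compA _ (phi a')) pmap_nat.
  rewrite -[pmap (shift C e G) aa']/(pmap G (lerD aa' (lexx e))) !compA.
  by rewrite (pmapM _ _ _ (le_trans a'b bb')) (pmapM _ _ _ ab').
by [].
Qed.

Lemma nattrans_of_shift_map e F G (f : shift_map e F G) :
  exists phi : nattrans F (shift C e G),
    forall a : R, phi a = f a (a + e) (lexx _).
Proof.
unshelve eexists.
  exists (fun a : R => f a (a + e) (lexx _)) => a b ab.
  pose ab' : a + e <= b + e := lerD ab (lexx e).
  change (comp (f b (b + e) (lexx _)) (pmap F ab) = comp (pmap G ab') (f a (a + e) (lexx _))).
  by rewrite (smap_natr f ab _ ab') (smap_natl f _ _ ab').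
by [].
Qed.

(** A transformation into the shift extends to all [a + e <= b] by a further structure map and is
    recovered at [b = a + e]; the interleaving identities at these least targets imply all the
    others. *)
Lemma interleavedP (e : {nonneg R}) F G :
  interleaved e F G <-> soft_interleaved e%:num F G.
Proof.
split=> [[phi [psi [E1 E2]]]|[f [g [fg gf]]]].
  have half A B (f : nattrans A (shift C e%:num B)) (g : nattrans B (shift C e%:num A))
      (f' : shift_map e%:num A B) (g' : shift_map e%:num B A) :
      (forall (a b : R) (ab : a + e%:num <= b), f' a b ab = comp (pmap B ab) (f a)) ->
      (forall (a b : R) (ab : a + e%:num <= b), g' a b ab = comp (pmap A ab) (g a)) ->
      nt_comp (fmap (shift C e%:num) g) f = shift_unit e A ->
      inverse_shift_maps f' g'.
    move=> f'E g'E E a b c ab bc ac; rewrite f'E g'E.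
    have Ea : comp (g (a + e%:num)) (f a) = pmap A (shift_unit_subproof e a).
      exact: (congr1 (fun t : @hom (pers R C) A _ => @ntapp _ _ _ _ t a) E).
    rewrite -compA (compA (g b)) pmap_nat -(compA _ (g _)) Ea.
    rewrite -[pmap (shift _ _ _) _]/(pmap A (lerD ab (lexx e%:num))).
    by rewrite (pmapM _ _ _ (le_trans (shift_unit_subproof e a) (lerD ab (lexx e%:num)))) pmapM.
  have [f fE] := shift_map_of_nattrans phi.
  have [g gE] := shift_map_of_nattrans psi.
  by exists f, g; split; [exact: half fE gE E1|exact: half gE fE E2].
have [phi phiE] := nattrans_of_shift_map f.
have [psi psiE] := nattrans_of_shift_map g.
exists phi, psi; split; apply: nattrans_ext => a /=.
  by rewrite phiE psiE; exact: fg.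
by rewrite phiE psiE; exact: gf.
Qed.

Lemma soft_interleaved_sym e F G : soft_interleaved e F G -> soft_interleaved e G F.
Proof. by move=> [f [g [fg gf]]]; exists g, f. Qed.

(** The composite does not depend on the intermediate index: [a + e1] serves to define it, and later
    uses pick whichever [b] is convenient. *)
Lemma shift_map_comp e1 e2 e3 F G H (f : shift_map e1 F G) (g : shift_map e2 G H) :
  e1 + e2 <= e3 ->
  exists h : shift_map e3 F H, forall (a b c : R) (ab : a + e1 <= b) (bc : b + e2 <= c)
    (ac : a + e3 <= c), h a c ac = comp (g b c bc) (f a b ab).
Proof.
move=> e123.
have le2 (a c : R) : a + e3 <= c -> a + e1 + e2 <= c.
  by move=> ac; rewrite -addrA (le_trans _ ac) ?lerD2l.
have hE (a b c : R) (ab : a + e1 <= b) (bc : b + e2 <= c) (ac : a + e3 <= c) :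
    comp (g (a + e1) c (le2 a c ac)) (f a (a + e1) (lexx _)) = comp (g b c bc) (f a b ab).
  by rewrite -(smap_natl _ (lexx (a + e1)) ab) compA (smap_natr _ _ _ (le2 a c ac)).
unshelve eexists.
  exists (fun (a c : R) ac => comp (g (a + e1) c (le2 a c ac)) (f a (a + e1) (lexx _))).
  move=> a a' c c' aa' a'c cc' ac'.
  have aa1 : a + e1 <= a' + e1 by rewrite lerD2r.
  rewrite -compA (smap_natr _ _ _ aa1) compA.
  rewrite (smap_natl _ _ _ (le_trans (le2 a' c a'c) cc')).
  by rewrite -(hE a (a' + e1) c' aa1 (le_trans (le2 a' c a'c) cc') ac').
by move=> a b c ab bc ac; exact: hE.
Qed.

Lemma soft_interleaved_trans e1 e2 e3 F G H : 0 <= e1 -> 0 <= e2 -> e1 + e2 <= e3 ->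
  soft_interleaved e1 F G -> soft_interleaved e2 G H -> soft_interleaved e3 F H.
Proof.
move=> e1_ge0 e2_ge0 e123 [f1 [g1 [fg1 gf1]]] [f2 [g2 [fg2 gf2]]].
have e213 : e2 + e1 <= e3 by rewrite addrC.
have [f fE] := shift_map_comp f1 f2 e123.
have [g gE] := shift_map_comp g2 g1 e213.
exists f, g; split=> a b c ab bc ac.
(* The path is factored through [a + e1] and [c - e1]: the two middle maps then meet at [b] and
   collapse to a structure map of [G], which is absorbed by its neighbour. *)
- have a1 : a + e1 <= a + e1 by [].
  have a1b : a + e1 + e2 <= b by rewrite -addrA (le_trans _ ab) ?lerD2l.
  have bd : b + e2 <= c - e1 by rewrite lerBrDr -addrA (le_trans _ bc) ?lerD2l.
  have dc : c - e1 + e1 <= c by rewrite subrK.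
  have a1d : a + e1 <= c - e1 by lra.
  rewrite (fE _ _ _ a1 a1b) (gE _ _ _ bd dc) -compA (compA (g2 _ _ _)).
  by rewrite (fg2 _ _ _ _ _ a1d) smap_natl ?(fg1 _ _ _ _ _ ac).
- have a1 : a + e2 <= a + e2 by [].
  have a1b : a + e2 + e1 <= b by rewrite -addrA (le_trans _ ab) ?lerD2l.
  have bd : b + e1 <= c - e2 by rewrite lerBrDr -addrA (le_trans _ bc) ?lerD2l.
  have dc : c - e2 + e2 <= c by rewrite subrK.
  have a1d : a + e2 <= c - e2 by lra.
  rewrite (gE _ _ _ a1 a1b) (fE _ _ _ bd dc) -compA (compA (f1 _ _ _)).
  by rewrite (gf1 _ _ _ _ _ a1d) smap_natl ?(gf2 _ _ _ _ _ ac).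
Qed.

Lemma shift_map_pmap e F : 0 <= e ->
  exists f : shift_map e F F,
    forall (a b : R) (ab : a + e <= b) (ab' : a <= b), f a b ab = pmap F ab'.
Proof.
move=> e_ge0.
have le (a b : R) : a + e <= b -> a <= b by apply: le_trans; rewrite lerDl.
unshelve eexists.
  exists (fun (a b : R) ab => pmap F (le a b ab)) => a a' b b' aa' a'b bb' ab'.
  by rewrite (pmapM _ _ _ (le_trans aa' (le _ _ a'b))) (pmapM _ _ _ (le _ _ ab')).
by move=> a b ab ab'; rewrite -(pmapM F (lexx a) (le a b ab) ab') pmap1 compc1.
Qed.

Lemma soft_interleaved_refl e F : 0 <= e -> soft_interleaved e F F.
Proof.
move=> e_ge0; have [f fE] := shift_map_pmap F e_ge0.
have le (a b : R) : a + e <= b -> a <= b by apply: le_trans; rewrite lerDl.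
by exists f, f; split=> a b c ab bc ac; rewrite !(fE _ _ _ (le _ _ _)) pmapM.
Qed.

Lemma soft_interleaved_le e e' F G : 0 <= e -> e <= e' ->
  soft_interleaved e F G -> soft_interleaved e' F G.
Proof.
move=> e_ge0 ee' FG; apply: (soft_interleaved_trans (e2 := 0) e_ge0 _ _ FG) => //.
  by rewrite addr0.
exact: soft_interleaved_refl.
Qed.

End SoftInterleaving.

Lemma soft_interleaved_fmap (R : realType) (C D : category) (T : functor C D) e
    (F G : pers R C) :
  soft_interleaved e F G ->
  soft_interleaved e (functor_comp T F : pers R D) (functor_comp T G : pers R D).
Proof.
have mk A B (f : shift_map e A B) : exists g : shift_map e (functor_comp T A : pers R D)
    (functor_comp T B : pers R D), forall a b ab, g a b ab = fmap T (f a b ab).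
  unshelve eexists.
    exists (fun (a b : R) ab => fmap T (f a b ab)) => a a' b b' aa' a'b bb' ab'.
    rewrite -(smap_nat f aa' a'b bb' ab').
    by rewrite !fmapM.
  by [].
move=> [f [g [fg gf]]]; have [f' f'E] := mk _ _ f; have [g' g'E] := mk _ _ g.
exists f', g'; split=> a b c ab bc ac; rewrite f'E g'E.
  by rewrite -[pmap _ _]/(fmap T (pmap F ac)) -(fg _ _ _ ab bc) fmapM.
by rewrite -[pmap _ _]/(fmap T (pmap G ac)) -(gf _ _ _ ab bc) fmapM.
Qed.

(** A common object map [o] lets the morphism maps be compared without transport. This is enough for
    reassociating composites, whose object maps are convertible. *)
Lemma functor_ext (C D : category) (o : C -> D)
    (m m' : forall X Y, hom X Y -> hom (o X) (o Y)) m1 mM m1' mM' :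
  (forall X Y (f : hom X Y), m X Y f = m' X Y f) ->
  @Functor C D o m m1 mM = @Functor C D o m' m1' mM'.
Proof.
move=> mm'; have {}mm' : m = m'.
  apply: functional_extensionality_dep => X; apply: functional_extensionality_dep => Y.
  exact/funext/mm'.
case: m' / mm' m1' mM' => m1' mM'.
by rewrite (Prop_irrelevance m1 m1') (Prop_irrelevance mM mM').
Qed.

(** * Distances as infima of interleaving parameters *)

Section InfDist.
Variable R : realType.
Local Open Scope ereal_scope.
Local Open Scope classical_set_scope.
Implicit Types P Q : {nonneg R} -> Prop.

Lemma inf_dist_le P Q : (forall e, P e -> Q e) -> inf_dist Q <= inf_dist P.
Proof.
move=> PQ; apply: ereal_inf_le_tmp => x [[e Pe <-]|->]; [left|by right].
by exists e => //; exact: PQ.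
Qed.

Lemma inf_dist_ge0 P : 0 <= inf_dist P.
Proof.
by apply: le_ereal_inf_tmp => x [[e _ <-]|->]; rewrite ?leey // lee_fin.
Qed.

Lemma inf_dist_lb P e : P e -> inf_dist P <= (e%:num)%:E.
Proof. by move=> Pe; apply: ereal_inf_lbound; left; exists e. Qed.

Lemma inf_dist_lt P (c : R) : inf_dist P < c%:E -> exists2 e, P e & (e%:num < c)%R.
Proof.
move=> /ereal_inf_lt[_ [[e Pe <-]|->]]; last by rewrite ltNge leey.
by rewrite lte_fin => ec; exists e.
Qed.

End InfDist.

(** * Trivial fibrations and pullbacks of complexes *)

Lemma quot_pi_linear (K : fieldType) (V : lmodType K) (U : V -> bool)
    (Umod : submod_closed U) : linear (quot_pi Umod).
Proof. by move=> a u v; rewrite quot_piD -quot_scaleE. Qed.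

Section TrivialFibrations.
Variable K : fieldType.

(* The right lifting property against the inclusions of spheres into disks:
   equivalently, f is a surjective quasi-isomorphism. *)
Definition trivial_fibration (X Y : cochain K) (f : cochain_map X Y) : Prop :=
  forall (i j k : int) (ij : i + 1 = j) (jk : j + 1 = k) (x' : X j) (y : Y i),
    cdiff X jk x' = 0 -> f j x' = cdiff Y ij y ->
    exists x : X i, cdiff X ij x = x' /\ f i x = y.

Lemma trivial_fibration_id (X : cochain K) : trivial_fibration (cochain_id X).
Proof. by move=> i j k ij jk x' y _ /= xy; exists y. Qed.

Lemma trivial_fibration_comp (X Y Z : cochain K) (g : cochain_map Y Z)
    (f : cochain_map X Y) :
  trivial_fibration g -> trivial_fibration f -> trivial_fibration (cochain_comp g f).
Proof.
move=> tg tf i j k ij jk x' z dx' gx'.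
have [|y [dy gy]] := tg i j k ij jk (f j x') z _ gx'; first by rewrite -cmap_diff dx' linear0.
by have [x [dx fx]] := tf i j k ij jk x' y dx' (esym dy); exists x; rewrite /= fx.
Qed.

(** Injectivity is the lifting property for a cocycle together with a cochain bounding its image;
    surjectivity is the lifting property with [x' = 0]. *)
Lemma trivial_fibration_quasi_iso (X Y : Ch K) (f : cochain_map X Y) :
  trivial_fibration f -> @quasi_iso K X Y f.
Proof.
move=> tf k.
have inj : injective (cohomology_map f k).
  move=> c c' /eqP; rewrite -subr_eq0 -linearB => /eqP fc; apply/eqP.
  rewrite -subr_eq0; apply/eqP; move: (c - c') fc => {c'} {}c.
  rewrite -[c]quot_piK /= cohomology_funE.
  move: (generic_quotient.repr c) => z.
  rewrite -(linear0 (mk_linear (quot_pi_linear (@is_coboundary_submod K Y k)))).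
  rewrite -(linear0 (mk_linear (quot_pi_linear (@is_coboundary_submod K X k)))).
  move=> /quot_piP/asboolP[w]; rewrite subr0 => dw.
  apply/quot_piP/asboolP; rewrite subr0.
  have [x [dx _]] := tf _ _ _ (subrK 1 k) _ (val z) w (eqP (valP z)) (esym dw).
  by exists x.
have surj d : exists c, cohomology_map f k c = d.
  rewrite -[d]quot_piK; move: (generic_quotient.repr d) => z.
  have [||x [dx fx]] := tf k _ _ erefl erefl 0 (val z); rewrite ?linear0 //.
    by rewrite (eqP (valP z)).
  have zx : is_cocycle x by rewrite /is_cocycle dx.
  exists (quot_pi (@is_coboundary_submod K X k) (exist _ x zx)).
  by rewrite /= cohomology_funE; congr quot_pi; apply: val_inj.
have [g gK] := choice surj.
by exists g => [c|//]; apply: inj.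
Qed.

End TrivialFibrations.

Section PullbackModule.
Variables (K : fieldType) (A B Y : lmodType K) (f : {linear A -> B}) (g : {linear Y -> B}).

Definition in_pullback : pred (A * Y)%type := fun p => f p.1 == g p.2.

Lemma in_pullback_submod : submod_closed in_pullback.
Proof.
split=> [|a u v]; rewrite !unfold_in /in_pullback /= ?linear0 // => /eqP fu /eqP fv.
by rewrite !linearP fu fv.
Qed.
HB.instance Definition _ :=
  GRing.isSubmodClosed.Build K (A * Y)%type in_pullback
    (GRing.submod_closed_semi in_pullback_submod).

Definition pullback := {p : (A * Y)%type | in_pullback p}.
HB.instance Definition _ := SubChoice.on pullback.
HB.instance Definition _ := [SubChoice_isSubLmodule of pullback by <:].

Lemma pullbackP (p : pullback) : f (val p).1 = g (val p).2.
Proof. exact: eqP (valP p). Qed.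

Definition pullback_pair (a : A) (y : Y) (ay : f a = g y) : pullback :=
  exist _ (a, y) (introT eqP ay).

Lemma pullback_fst_linear : linear (fun p : pullback => (val p).1).
Proof. by move=> a p q; rewrite linearP. Qed.
Lemma pullback_snd_linear : linear (fun p : pullback => (val p).2).
Proof. by move=> a p q; rewrite linearP. Qed.

Lemma pullback_pair_linear (U : lmodType K) (s : {linear U -> A}) (t : {linear U -> Y})
    (st : forall u, f (s u) = g (t u)) :
  linear (fun u => pullback_pair (st u)).
Proof. by move=> a u v; apply: val_inj; rewrite /= !linearP. Qed.

End PullbackModule.

Section PullbackComplex.
Variables (K : fieldType) (A B Y : cochain K) (f : cochain_map A B) (g : cochain_map Y B).

Lemma pullback_diff_subproof (i j : int) (ij : i + 1 = j) (p : pullback (f i) (g i)) :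
  f j (cdiff A ij (val p).1) = g j (cdiff Y ij (val p).2).
Proof. by rewrite !cmap_diff pullbackP. Qed.

Definition pullback_diff (i j : int) (ij : i + 1 = j) (p : pullback (f i) (g i)) :
  pullback (f j) (g j) := pullback_pair (pullback_diff_subproof ij p).

Lemma pullback_diff_linear (i j : int) (ij : i + 1 = j) : linear (pullback_diff ij).
Proof. by move=> a p q; apply: val_inj; rewrite /= !linearP. Qed.

Definition pullback_complex : cochain K.
Proof.
exists (fun i => pullback (f i) (g i)) (fun i j ij => mk_linear (pullback_diff_linear ij)).
by move=> i j k ij jk p; apply: val_inj; rewrite /= !cdiffK.
Defined.

Definition pullback_fst : cochain_map pullback_complex A.
Proof. by exists (fun i => mk_linear (@pullback_fst_linear _ _ _ _ (f i) (g i))). Defined.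

Definition pullback_snd : cochain_map pullback_complex Y.
Proof. by exists (fun i => mk_linear (@pullback_snd_linear _ _ _ _ (f i) (g i))). Defined.

Lemma trivial_fibration_pullback_fst : trivial_fibration g -> trivial_fibration pullback_fst.
Proof.
move=> tg i j k ij jk p a dp /= pa.
have [||y [dy gy]] := tg i j k ij jk (val p).2 (f i a).
- by have := congr1 (fun q => (val q).2) dp.
- by rewrite -cmap_diff -pa pullbackP.
exists (pullback_pair (esym gy)); split=> //; apply: val_inj.
by rewrite /= dy -pa -surjective_pairing.
Qed.

Lemma trivial_fibration_pullback_snd : trivial_fibration f -> trivial_fibration pullback_snd.
Proof.
move=> tf i j k ij jk p y dp /= py.
have [||a [da fa]] := tf i j k ij jk (val p).1 (g i y).
- by have := congr1 (fun q => (val q).1) dp.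
- by rewrite -cmap_diff -py pullbackP.
exists (pullback_pair fa); split=> //; apply: val_inj.
by rewrite /= da -py -surjective_pairing.
Qed.

End PullbackComplex.

Definition pullback_lift (K : fieldType) (Z A B Y : cochain K) (f : cochain_map A B)
  (g : cochain_map Y B) (s : cochain_map Z A) (t : cochain_map Z Y)
  (st : forall i z, f i (s i z) = g i (t i z)) : cochain_map Z (pullback_complex f g).
Proof.
exists (fun i => mk_linear (pullback_pair_linear (st i))).
by move=> i j ij z; apply: val_inj; rewrite /= !cmap_diff.
Defined.

(** * Interleavings up to spans of trivial fibrations *)

Lemma cochain_map_congr (K : fieldType) (X Y : cochain K) (f g : cochain_map X Y) :
  f = g -> forall k (x : X k), f k x = g k x.
Proof. by move=> ->. Qed.

Section PullbackFunctor.
Variables (K : fieldType) (I : category) (A B Y : functor I (Ch K)).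
Variables (u : nattrans A B) (v : nattrans Y B).

Let P (a : I) : cochain K := pullback_complex (u a) (v a).

Lemma pullback_fmap_subproof (a b : I) (f : hom a b) (i : int) (p : P a i) :
  (u b : cochain_map _ _) i ((fmap A f : cochain_map _ _) i (val p).1) =
  (v b : cochain_map _ _) i ((fmap Y f : cochain_map _ _) i (val p).2).
Proof.
have := cochain_map_congr (ntnat u f) (val p).1 => /= ->.
have := cochain_map_congr (ntnat v f) (val p).2 => /= ->.
by rewrite pullbackP.
Qed.

Definition pullback_functor : functor I (Ch K).
Proof.
exists (fun a => P a : Ch K)
  (fun a b f => pullback_lift
     (s := cochain_comp (fmap A f) (pullback_fst (u a) (v a)))
     (t := cochain_comp (fmap Y f) (pullback_snd (u a) (v a)))
     (@pullback_fmap_subproof a b f)).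
- move=> a; apply: cochain_map_ext => i p; apply: val_inj => /=.
  by rewrite !fmap1 /= -surjective_pairing.
- move=> a b c g f; apply: cochain_map_ext => i p; apply: val_inj => /=.
  by rewrite !fmapM.
Defined.

Definition pullback_functor_fst : nattrans pullback_functor A.
Proof.
exists (fun a => pullback_fst (u a) (v a) : @hom (Ch K) (pullback_functor a) (A a)).
by move=> a b f; apply: cochain_map_ext.
Defined.

Definition pullback_functor_snd : nattrans pullback_functor Y.
Proof.
exists (fun a => pullback_snd (u a) (v a) : @hom (Ch K) (pullback_functor a) (Y a)).
by move=> a b f; apply: cochain_map_ext.
Defined.

End PullbackFunctor.

Section HomotopyRelation.
Variables (K : fieldType) (R : realType).
Implicit Types X Y Z : pers R (Ch K).

Definition pointwise_trivial_fibration (I : category) (X Y : functor I (Ch K))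
    (f : nattrans X Y) : Prop :=
  forall a : I, trivial_fibration (f a : cochain_map _ _).

Lemma pointwise_trivial_fibration_comp (I : category) (X Y Z : functor I (Ch K))
    (g : nattrans Y Z) (f : nattrans X Y) :
  pointwise_trivial_fibration g -> pointwise_trivial_fibration f ->
  pointwise_trivial_fibration (nt_comp g f).
Proof. by move=> tg tf a; apply: trivial_fibration_comp. Qed.

(* A' a consists of the pairs (x, y) in A a * Y (a + e) with f x = p y. *)
Lemma soft_interleaved_pullback e A B Y (p : nattrans Y B) : 0 <= e ->
  pointwise_trivial_fibration p -> soft_interleaved e A B ->
  exists A' (q : nattrans A' A), pointwise_trivial_fibration q /\ soft_interleaved e A' Y.
Proof.
move=> e_ge0 tp [f [g [fg gf]]].
have [u uE] := nattrans_of_shift_map f.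
pose v := fmap (shift (Ch K) e) (p : @hom (pers R (Ch K)) Y B).
pose A' := pullback_functor u v.
exists A', (pullback_functor_fst u v); split.
  by move=> a; apply: trivial_fibration_pullback_fst; exact: tp.
pose F (a b : R) (ab : a + e <= b) : @hom (Ch K) (A' a) (Y b) :=
  comp (pmap Y ab) (pullback_functor_snd u v a).
have ple (a b : R) : a + e <= b -> a <= b + e.
  by move=> ab; rewrite (@le_trans _ _ (a + e)) ?lerDl// (le_trans ab)// lerDl.
(* The pair of [g (p y)] and the image of [y] in [Y (b + e)] lies in the pullback: [f] after [g] is
   a structure map of [B], and [p] commutes with structure maps. *)
have Gst (a b : R) (ab : a + e <= b) i (y : (Y a : cochain K) i) :
    (u b : cochain_map _ _) i ((g a b ab : cochain_map _ _) i ((p a : cochain_map _ _) i y)) =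
    (v b : cochain_map _ _) i ((pmap Y (ple a b ab) : cochain_map _ _) i y).
  rewrite uE.
  have := cochain_map_congr (gf a b (b + e) ab (lexx _) (ple a b ab))
    ((p a : cochain_map _ _) i y).
  move=> /= ->.
  have := cochain_map_congr (pmap_nat p (ple a b ab)) y.
  by move=> /= ->.
pose G (a b : R) (ab : a + e <= b) : @hom (Ch K) (Y a) (A' b) :=
  pullback_lift (s := cochain_comp (g a b ab) (p a)) (t := pmap Y (ple a b ab)) (Gst a b ab).
have [F' F'E] : exists F' : shift_map e A' Y, forall a b ab, F' a b ab = F a b ab.
  unshelve eexists.
    unshelve eapply ShiftMap; first exact: F.
    move=> a a' b b' aa' a'b bb' ab'.
    rewrite /F -(compA _ (pullback_functor_snd u v a')) pmap_nat.
    rewrite -[pmap (shift _ _ _) _]/(pmap Y (lerD aa' (lexx e))) !compA.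
    by rewrite (pmapM _ _ _ (le_trans a'b bb')) (pmapM _ _ _ ab').
  by [].
have [G' G'E] : exists G' : shift_map e Y A', forall a b ab, G' a b ab = G a b ab.
  unshelve eexists.
    unshelve eapply ShiftMap; first exact: G.
    move=> a a' b b' aa' a'b bb' ab'.
    apply: cochain_map_ext => i y; apply: val_inj.
    rewrite [LHS]/= [RHS]/=; congr pair.
      rewrite -(smap_nat g aa' a'b bb' ab') /=; congr (cmap _ _ _); congr (cmap _ _ _).
      exact: (cochain_map_congr (pmap_nat p aa') y).
    have ab2 : a <= b + e := le_trans aa' (ple _ _ a'b).
    rewrite -(pmapM Y ab2 (lerD bb' (lexx e))) -(pmapM Y aa' (ple _ _ a'b)).
    by [].
  by [].
exists F', G'; split=> a b c ab bc ac; rewrite F'E G'E; apply: cochain_map_ext => i x.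
  apply: val_inj; rewrite [LHS]/= [RHS]/=; congr pair.
    (* On a pair [(x, y)] the pullback equation replaces [p y] by [f x], which turns the first
       component into [g] after [f]. *)
    rewrite -(cochain_map_congr (fg a b c ab bc ac)) /=; congr (cmap _ _ _).
    have := cochain_map_congr (pmap_nat p ab) (val x).2 => /= ->.
    rewrite -[(p _ : cochain_map _ _) _ _]/((v a : cochain_map _ _) i (val x).2).
    rewrite -pullbackP; move: (val x).1 => x1; rewrite uE.
    exact: (cochain_map_congr (smap_natl f _ ab ab)).
  exact: (cochain_map_congr (pmapM Y ab (ple _ _ bc) _)).
exact: (cochain_map_congr (pmapM Y (ple _ _ ab) bc ac)).
Qed.

(** The two interleavings end at different objects over [Y]. The pullback of [y1] and [y2] maps to
    both by trivial fibrations, and pulling each interleaving back to it gives them a common middle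
    object. *)
Lemma soft_interleaved_span e1 e2 e3 X Y Z (X' Y1 Y2 Z' : pers R (Ch K))
    (x : nattrans X' X) (y1 : nattrans Y1 Y) (y2 : nattrans Y2 Y) (z : nattrans Z' Z) :
  0 <= e1 -> 0 <= e2 -> e1 + e2 <= e3 ->
  pointwise_trivial_fibration x -> pointwise_trivial_fibration y1 ->
  pointwise_trivial_fibration y2 -> pointwise_trivial_fibration z ->
  soft_interleaved e1 X' Y1 -> soft_interleaved e2 Y2 Z' ->
  exists X'' Z'' (x' : nattrans X'' X) (z' : nattrans Z'' Z),
    [/\ pointwise_trivial_fibration x', pointwise_trivial_fibration z' &
        soft_interleaved e3 X'' Z''].
Proof.
move=> e1_ge0 e2_ge0 e123 tx ty1 ty2 tz XY YZ.
have t1 : pointwise_trivial_fibration (pullback_functor_fst y1 y2).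
  by move=> a; apply: trivial_fibration_pullback_fst; exact: ty2.
have t2 : pointwise_trivial_fibration (pullback_functor_snd y1 y2).
  by move=> a; apply: trivial_fibration_pullback_snd; exact: ty1.
have [X'' [x' [tx' XV]]] := soft_interleaved_pullback e1_ge0 t1 XY.
have [Z'' [z' [tz' ZV]]] :=
  soft_interleaved_pullback e2_ge0 t2 (soft_interleaved_sym YZ).
exists X'', Z'', (nt_comp x x'), (nt_comp z z'); split.
- exact: pointwise_trivial_fibration_comp.
- exact: pointwise_trivial_fibration_comp.
- exact: soft_interleaved_trans e1_ge0 e2_ge0 e123 XV (soft_interleaved_sym ZV).
Qed.

Definition span_interleaved e X Y :=
  exists X' Y' (x : nattrans X' X) (y : nattrans Y' Y),
    [/\ pointwise_trivial_fibration x, pointwise_trivial_fibration y &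
        soft_interleaved e X' Y'].

Lemma span_interleaved_sym e X Y : span_interleaved e X Y -> span_interleaved e Y X.
Proof.
move=> [X' [Y' [x [y [tx ty XY]]]]]; exists Y', X', y, x.
by split=> //; exact: soft_interleaved_sym.
Qed.

Lemma span_interleaved_trans e1 e2 e3 X Y Z : 0 <= e1 -> 0 <= e2 -> e1 + e2 <= e3 ->
  span_interleaved e1 X Y -> span_interleaved e2 Y Z -> span_interleaved e3 X Z.
Proof.
move=> e1_ge0 e2_ge0 e123 [X' [Y1 [x [y1 [tx ty1 XY]]]]] [Y2 [Z' [y2 [z [ty2 tz YZ]]]]].
exact: soft_interleaved_span tx ty1 ty2 tz XY YZ.
Qed.

Lemma soft_interleaved_span_interleaved e X Y :
  soft_interleaved e X Y -> span_interleaved e X Y.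
Proof.
by move=> XY; exists X, Y, (nt_id X), (nt_id Y); split=> // a; exact: trivial_fibration_id.
Qed.

Lemma span_interleaved_homotopy (e : {nonneg R}) X Y :
  span_interleaved e%:num X Y -> homotopy_interleaved e X Y.
Proof.
move=> [X' [Y' [x [y [tx ty XY]]]]]; exists X', Y'; split; last exact/interleavedP.
- apply: (@we_bwd (pers R (Ch K)) _ X X' X' x); last exact: we_refl.
  by move=> r; exact: trivial_fibration_quasi_iso (tx r).
- apply: (@we_bwd (pers R (Ch K)) _ Y Y' Y' y); last exact: we_refl.
  by move=> r; exact: trivial_fibration_quasi_iso (ty r).
Qed.

End HomotopyRelation.

(** * Sections of cohomology and graded complexes *)

Section DependentProductMaps.
Variables (K : fieldType) (I : Type) (V : I -> lmodType K).

Lemma dprod_proj_linear (i : I) : linear (fun f : dprod V => f i).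
Proof. by []. Qed.

Definition dprod_proj (i : I) : {linear dprod V -> V i} := mk_linear (dprod_proj_linear i).

Definition dprod_tuple (U : lmodType K) (f : forall i, {linear U -> V i}) :
  {linear U -> dprod V}.
Proof.
refine (@mk_linear K U (dprod V) (fun u => fun i => f i u) _).
by move=> a u v; apply: dprod_ext => i; rewrite linearP.
Defined.

End DependentProductMaps.

Definition pair_linear (K : fieldType) (U V W : lmodType K) (f : {linear U -> V})
  (g : {linear U -> W}) : {linear U -> (V * W)%type}.
Proof.
refine (@mk_linear K U (V * W)%type (fun u => (f u, g u)) _).
by move=> a u v; rewrite !linearP.
Defined.

Section Cast.
Variables (K : fieldType) (X : cochain K).

(** The homotopy model mixes a degree with its shifts: it needs maps into degree [j - 1] from degree
    [i], where only [i + 1 = j] is known. *)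
Definition cast_degree (i j : int) (e : i = j) : {linear X i -> X j} :=
  match e with erefl => idfun end.

Lemma cast_degree_diff (i j i' j' : int) (ij : i + 1 = j) (ij' : i' + 1 = j')
    (e : i = i') (e' : j = j') (x : X i) :
  cdiff X ij' (cast_degree e x) = cast_degree e' (cdiff X ij x).
Proof.
case: i' / e ij'; case: j' / e' => ij' /=.
by rewrite (Prop_irrelevance ij ij').
Qed.

End Cast.

Lemma cast_degree_map (K : fieldType) (X Y : cochain K) (f : cochain_map X Y)
    (i j : int) (e : i = j) (x : X i) :
  f j (cast_degree X e x) = cast_degree Y e (f i x).
Proof. by case: j / e. Qed.

Section CohomologySection.
Variables (K : fieldType).

Definition cohomology_section_of (X : cochain K) (k : int)
    (s : cohomology X k -> X k) : Prop :=
  forall c, exists2 z : cocycle X k, val z = s c & quot_pi (@is_coboundary_submod K X k) z = c.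

Lemma cohomology_section_exists (X : cochain K) (k : int) :
  exists s : {linear cohomology X k -> X k}, cohomology_section_of s.
Proof.
have [u|l lK] := @linear_lift K (cohomology X k) (cocycle X k) (cohomology X k)
  idfun (mk_linear (quot_pi_linear (@is_coboundary_submod K X k))).
  by exists (generic_quotient.repr u); exact: quot_piK.
have sl : linear (fun c => val (l c) : X k) by move=> a u v; rewrite !linearP.
by exists (mk_linear sl) => c; exists (l c) => //; exact: lK.
Qed.

Variables (X : cochain K) (k : int) (s : {linear cohomology X k -> X k}).
Hypothesis sP : cohomology_section_of s.

Lemma cohomology_section_cocycle (l : int) (kl : k + 1 = l) (c : cohomology X k) :
  cdiff X kl (s c) = 0.
Proof. by case: l / kl; have [z <- _] := sP c; exact/eqP/(valP z). Qed.

Lemma cohomology_section_surj (l : int) (kl : k + 1 = l) (x : X k) :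
  cdiff X kl x = 0 -> exists c (w : X (k - 1)), cdiff X (subrK 1 k) w = x - s c.
Proof.
case: l / kl => dx; have zx : is_cocycle x by rewrite /is_cocycle dx.
pose z : cocycle X k := exist _ x zx.
exists (quot_pi (@is_coboundary_submod K X k) z).
have [z' <- /esym/quot_piP/asboolP[w dw]] := sP (quot_pi (@is_coboundary_submod K X k) z).
by exists w.
Qed.

Lemma cohomology_section_inj (c : cohomology X k) (w : X (k - 1)) :
  cdiff X (subrK 1 k) w = s c -> c = 0.
Proof.
have [z <- <-] := sP c => dw.
rewrite -(linear0 (mk_linear (quot_pi_linear (@is_coboundary_submod K X k)))).
by apply/quot_piP/asboolP; exists w; rewrite subr0.
Qed.

(** Both ways around the naturality square pick representatives of the same class, so they differ by
    a coboundary; [linear_lift] makes the bounding cochain linear in [c]. *)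
Lemma cohomology_section_nat (Y : cochain K) (t : {linear cohomology Y k -> Y k})
    (f : cochain_map X Y) :
  cohomology_section_of t ->
  exists h : {linear cohomology X k -> Y (k - 1)}, forall c,
    cdiff Y (subrK 1 k) (h c) = f k (s c) - t (cohomology_map f k c).
Proof.
move=> tP.
pose u : {linear cohomology X k -> Y k} := (f k \o s) \- (t \o cohomology_map f k).
have [c|h hE] := @linear_lift K _ _ _ u (cdiff Y (subrK 1 k)); last by exists h.
rewrite /u /=; have [z zs zc] := sP c.
rewrite -zs -zc cohomology_funE.
have [z' <- /esym/quot_piP/asboolP[w dw]] :=
  tP (quot_pi (@is_coboundary_submod K Y k) (cocycle_map f z)).
by exists w.
Qed.

End CohomologySection.

Definition int_poset : category.
Proof.
exists int (fun a b : int => a <= b) (fun a => lexx a)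
       (fun a b c (bc : b <= c) (ab : a <= b) => le_trans ab bc).
all: by move=> *; exact: Prop_irrelevance.
Defined.

Section Graded.
Variables (K : fieldType) (I : category) (V : int -> functor I (vect K)).

Definition graded_complex (a : I) : cochain K :=
  @Cochain K (fun k => V k a : lmodType K) (fun i j _ => \0) (fun i j k ij jk x => erefl).

Definition graded_map (a b : I) (f : hom a b) :
  cochain_map (graded_complex a) (graded_complex b).
Proof.
exists (fun k => fmap (V k) f : {linear (V k a : lmodType K) -> (V k b : lmodType K)}).
by move=> i j ij x /=; rewrite linear0.
Defined.

Definition graded : functor I (Ch K).
Proof.
exists (graded_complex : I -> Ch K) graded_map.
- by move=> a; apply: cochain_map_ext => k x /=; rewrite fmap1.
- by move=> a b c g f; apply: cochain_map_ext => k x /=; rewrite fmapM.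
Defined.

End Graded.

(** * Formality of integer-indexed persistent complexes *)

Section Formality.
Variables (K : fieldType) (M : functor int_poset (Ch K)).

Let Mc (a : int) : cochain K := M a.
Let H (a k : int) : lmodType K := cohomology (Mc a) k.

Definition zmap (a b : int) (ab : a <= b) : cochain_map (Mc a) (Mc b) :=
  @fmap int_poset (Ch K) M a b ab.

Lemma zmapM (a b c : int) (ab : a <= b) (bc : b <= c) (ac : a <= c) i (x : Mc a i) :
  zmap bc i (zmap ab i x) = zmap ac i x.
Proof.
have := cochain_map_congr (@fmapM int_poset (Ch K) M a b c bc ab) x => /= <-.
congr (cmap _ _ _); congr (fmap M _); exact: (@Prop_irrelevance (a <= c)).
Qed.

Lemma zmap1 (a : int) (aa : a <= a) i (x : Mc a i) : zmap aa i x = x.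
Proof.
have := cochain_map_congr (@fmap1 int_poset (Ch K) M a) x => /= E.
rewrite -[RHS]E; congr (cmap _ _ _); congr (fmap M _); exact: (@Prop_irrelevance (a <= a)).
Qed.

Definition hmap (a b : int) (ab : a <= b) (k : int) : {linear H a k -> H b k} :=
  cohomology_map (zmap ab) k.

Lemma hmapM (a b c : int) (ab : a <= b) (bc : b <= c) (ac : a <= c) k (x : H a k) :
  hmap bc k (hmap ab k x) = hmap ac k x.
Proof.
have /(congr1 (fun f : {linear _ -> _} => f x)) /= <- :=
  @fmapM _ _ (functor_comp (cohomology_functor K k) M) a b c bc ab.
by congr ((cohomology_map _ k : {linear _ -> _}) x); congr (fmap M _);
  exact: (@Prop_irrelevance (a <= c)).
Qed.

Lemma hmap1 (a : int) (aa : a <= a) k (x : H a k) : hmap aa k x = x.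
Proof.
have /(congr1 (fun f : {linear _ -> _} => f x)) /= E :=
  @fmap1 _ _ (functor_comp (cohomology_functor K k) M) a.
rewrite -[RHS]E; congr ((cohomology_map _ k : {linear _ -> _}) x); congr (fmap M _).
exact: (@Prop_irrelevance (a <= a)).
Qed.

Lemma le_next (n : int) : n <= n + 1.
Proof. by rewrite lerDl. Qed.

Variable s : forall n k : int, {linear H n k -> Mc n k}.
Hypothesis sP : forall n k, cohomology_section_of (s n k).
Variable h : forall n k : int, {linear H n k -> Mc (n + 1) (k - 1)}.
Hypothesis hP : forall n k (c : H n k),
  cdiff (Mc (n + 1)) (subrK 1 k) (h n k c) =
  zmap (le_next n) k (s n k c) - s (n + 1) k (hmap (le_next n) k c).

Definition up_set (n : int) := {z : int | n <= z}.

Definition up_next n (z : up_set n) : up_set n :=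
  exist _ (sval z + 1) (le_trans (svalP z) (le_next (sval z))).

Definition up_start n : up_set n := exist _ n (lexx n).

Definition up_shift (n n' : int) (nn' : n <= n') (z : up_set n') : up_set n :=
  exist _ (sval z) (le_trans nn' (svalP z)).

(* Degree i of the homotopy model: in (x, c, y, w), the component y z is a homotopy in
   M z between the images of x and of the cocycle chosen for c, and w z a second-order
   homotopy between the image of y z and y (z + 1). *)
Definition res_obj (n i : int) : lmodType K :=
  (Mc n i * H n i * dprod (fun z : up_set n => Mc (sval z) (i - 1))
    * dprod (fun z : up_set n => Mc (sval z + 1) (i - 1 - 1)))%type.

Definition res_x n i : {linear res_obj n i -> Mc n i} := fst \o (fst \o fst).
Definition res_c n i : {linear res_obj n i -> H n i} := snd \o (fst \o fst).
Definition res_y n i (z : up_set n) : {linear res_obj n i -> Mc (sval z) (i - 1)} :=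
  dprod_proj _ z \o (snd \o fst).
Definition res_w n i (z : up_set n) : {linear res_obj n i -> Mc (sval z + 1) (i - 1 - 1)} :=
  dprod_proj _ z \o snd.

Lemma res_ext n i (p q : res_obj n i) :
  res_x n i p = res_x n i q -> res_c n i p = res_c n i q ->
  (forall z, res_y i z p = res_y i z q) -> (forall z, res_w i z p = res_w i z q) ->
  p = q.
Proof.
case: p q => [[[x c] y] w] [[[x' c'] y'] w'] /= -> -> /dprod_ext yy' /dprod_ext ww'.
by congr (_, _, _, _).
Qed.

Definition res_tuple (U : lmodType K) n i (x : {linear U -> Mc n i}) (c : {linear U -> H n i})
    (y : forall z : up_set n, {linear U -> Mc (sval z) (i - 1)})
    (w : forall z : up_set n, {linear U -> Mc (sval z + 1) (i - 1 - 1)}) :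
  {linear U -> res_obj n i} :=
  pair_linear (pair_linear (pair_linear x c) (dprod_tuple y)) (dprod_tuple w).

Section Diff.
Variables (n i j : int) (ij : i + 1 = j).

Fact res_deg1 : i = j - 1. Proof. by rewrite -ij addrK. Qed.
Fact res_deg2 : i - 1 = j - 1 - 1. Proof. by rewrite -ij addrK. Qed.
Fact res_deg3 : i - 1 + 1 = j - 1. Proof. by rewrite subrK res_deg1. Qed.
Fact res_deg4 : i - 1 - 1 + 1 = j - 1 - 1. Proof. by rewrite subrK res_deg2. Qed.

Definition res_diff_y (z : up_set n) : {linear res_obj n i -> Mc (sval z) (j - 1)} :=
  (cast_degree (Mc (sval z)) res_deg1
     \o ((zmap (svalP z) i \o res_x n i) \- (s _ i \o (hmap (svalP z) i \o res_c n i))))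
  \- (cdiff (Mc (sval z)) res_deg3 \o res_y i z).

Definition res_diff_w (z : up_set n) : {linear res_obj n i -> Mc (sval z + 1) (j - 1 - 1)} :=
  (cast_degree (Mc (sval z + 1)) res_deg2
     \o (((zmap (le_next (sval z)) (i - 1) \o res_y i z) \- res_y i (up_next z))
         \+ (h _ i \o (hmap (svalP z) i \o res_c n i))))
  \+ (cdiff (Mc (sval z + 1)) res_deg4 \o res_w i z).

(** An iterated mapping cocone. The [y] part compares [x] with the representative of [c] at every
    later index; the [w] part compares consecutive [y], where [h] makes up for the representatives
    not being natural. The sign of the inner differential alternates: minus on [y], plus on [w]. *)
Definition res_diff : {linear res_obj n i -> res_obj n j} :=
  res_tuple (cdiff (Mc n) ij \o res_x n i) \0 res_diff_y res_diff_w.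

End Diff.

Lemma h_diff n i j (ij : i + 1 = j) (c : H n i) :
  cdiff (Mc (n + 1)) (res_deg3 ij) (h n i c) =
  cast_degree _ (res_deg1 ij)
    (zmap (le_next n) i (s n i c) - s (n + 1) i (hmap (le_next n) i c)).
Proof. by rewrite -hP -(cast_degree_diff (subrK 1 i) (res_deg3 ij) erefl). Qed.

Lemma res_diff_cancel (V : zmodType) (p q r t u : V) :
  p - q - (r - t) + (q - t + u) = p - r + u.
Proof.
have E : - q + t + (q - t + u) = u.
  by rewrite addrA addrACA addNr [t - t]subrr addr0 add0r.
by rewrite opprB (addrC t) [p - q + _]addrACA -(addrA (p - r)) E.
Qed.

(** In the [w] component the differentials of the [y] terms cancel; what is left is the naturality
    defect of the section against the coboundary of [h], and these cancel by the choice of [h]. *)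
Lemma res_diffK n i j k (ij : i + 1 = j) (jk : j + 1 = k) (p : res_obj n i) :
  res_diff n jk (res_diff n ij p) = 0.
Proof.
set x := res_x n i p; set c := res_c n i p.
have yE z : res_y j z (res_diff n ij p) = cast_degree _ (res_deg1 ij)
    (zmap (svalP z) i x - s _ i (hmap (svalP z) i c))
    - cdiff _ (res_deg3 ij) (res_y i z p) by [].
have wE z : res_w j z (res_diff n ij p) = cast_degree _ (res_deg2 ij)
    (zmap (le_next (sval z)) (i - 1) (res_y i z p) - res_y i (up_next z) p
     + h _ i (hmap (svalP z) i c))
    + cdiff _ (res_deg4 ij) (res_w i z p) by [].
apply: res_ext => [|//|z|z].
- by rewrite linear0; exact: cdiffK.
- rewrite linear0 [LHS]/= linear0 linear0 subr0.
  rewrite linearB (cast_degree_diff ij _ _ (res_deg1 jk)) cdiffK subr0 linearB.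
  by rewrite (cohomology_section_cocycle (@sP _ _)) subr0 cmap_diff subrr.
- rewrite linear0.
  transitivity (cast_degree _ (res_deg2 jk)
    (zmap (le_next (sval z)) (j - 1) (res_y j z (res_diff n ij p))
       - res_y j (up_next z) (res_diff n ij p) + h _ j (hmap (svalP z) j 0))
    + cdiff _ (res_deg4 jk) (res_w j z (res_diff n ij p))); first by [].
  rewrite !linear0 addr0 !yE wE.
  rewrite [cdiff _ _ (_ + _)]linearD cdiffK addr0.
  rewrite (cast_degree_diff (res_deg3 ij) _ _ (res_deg2 jk)) -linearD.
  rewrite [cdiff _ _ (_ + _)]linearD [cdiff _ _ (_ - _)]linearB h_diff.
  rewrite [zmap _ _ (_ - _)]linearB cmap_diff cast_degree_map.
  rewrite res_diff_cancel -linearB -linearD.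
  rewrite linearB opprB (zmapM _ _ (svalP (up_next z))) (hmapM _ _ (svalP (up_next z))).
  by rewrite [_ - _ + (_ - _)]addrC subrKA subrKA subrr !linear0.
Qed.

Definition res_complex (n : int) : cochain K := Cochain (@res_diffK n).

Lemma res_y_irrelevance n i (p : res_obj n i) (v : int) (nv nv' : n <= v) :
  res_y i (exist _ v nv) p = res_y i (exist _ v nv') p.
Proof. by rewrite (Prop_irrelevance nv nv'). Qed.

Lemma res_w_irrelevance n i (p : res_obj n i) (v : int) (nv nv' : n <= v) :
  res_w i (exist _ v nv) p = res_w i (exist _ v nv') p.
Proof. by rewrite (Prop_irrelevance nv nv'). Qed.

Lemma res_y_shift1 n i (p : res_obj n i) (nn : n <= n) (z : up_set n) :
  res_y i (up_shift nn z) p = res_y i z p.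
Proof. by case: z => v nv; rewrite /up_shift; exact: (res_y_irrelevance p _ nv). Qed.

Lemma res_w_shift1 n i (p : res_obj n i) (nn : n <= n) (z : up_set n) :
  res_w i (up_shift nn z) p = res_w i z p.
Proof. by case: z => v nv; rewrite /up_shift; exact: (res_w_irrelevance p _ nv). Qed.

Definition res_map_fun (n n' : int) (nn' : n <= n') (i : int) :
  {linear res_obj n i -> res_obj n' i} :=
  res_tuple (zmap nn' i \o res_x n i) (hmap nn' i \o res_c n i)
    (fun z => res_y i (up_shift nn' z)) (fun z => res_w i (up_shift nn' z)).

Lemma res_map_diff (n n' : int) (nn' : n <= n') (i j : int) (ij : i + 1 = j)
    (p : res_obj n i) :
  res_map_fun nn' j (res_diff n ij p) = res_diff n' ij (res_map_fun nn' i p).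
Proof.
apply: res_ext => [||z|z].
- exact: cmap_diff.
- by rewrite /= linear0.
- rewrite [RHS]/= -[cohomology_fun (zmap nn') _]/(hmap nn' i _).
  by rewrite (zmapM _ _ (svalP (up_shift nn' z))) (hmapM _ _ (svalP (up_shift nn' z))).
- rewrite [RHS]/= -[cohomology_fun (zmap nn') _]/(hmap nn' i _).
  rewrite (hmapM _ _ (svalP (up_shift nn' z))) [LHS]/=.
  have yE : res_y i (up_next (up_shift nn' z)) p = res_y i (up_shift nn' (up_next z)) p.
    exact: res_y_irrelevance.
  rewrite -[p.1.2 (up_next _)]/(res_y i (up_next (up_shift nn' z)) p) yE.
  by [].
Qed.

Definition res_map (n n' : int) (nn' : n <= n') :
  cochain_map (res_complex n) (res_complex n') :=
  @CochainMap K (res_complex n) (res_complex n') (res_map_fun nn') (res_map_diff nn').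

Definition resolution : functor int_poset (Ch K).
Proof.
exists (res_complex : int_poset -> Ch K) res_map.
- move=> n; apply: cochain_map_ext => i p; apply: res_ext => [||z|z] /=.
  + exact: zmap1.
  + exact: hmap1.
  + exact: (@res_y_shift1 n).
  + exact: (@res_w_shift1 n).
- move=> n n' n'' nn' n'n''; apply: cochain_map_ext => i p; apply: res_ext => [||z|z] /=.
  + by rewrite (zmapM _ _ (le_trans n'n'' nn')).
  + by symmetry; exact: hmapM.
  + refine (@res_y_irrelevance n i p (sval z) _ _).
  + refine (@res_w_irrelevance n i p (sval z) _ _).
Defined.

(** The type of [y z] varies with [z]. The recursion runs over natural numbers [j] at the index
    [n + j], and structure maps along inequalities between equal indices play the part of
    transports. *)
Lemma up_recursion n k (a : Mc n k) (w : forall z : up_set n, Mc (sval z + 1) k) :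
  exists y : forall z : up_set n, Mc (sval z) k, y (up_start n) = a /\
    forall z, y (up_next z) = zmap (le_next (sval z)) k (y z) + w z.
Proof.
have nj (j : nat) : n <= n + j%:Z by rewrite lerDl.
have nSj (j : nat) : n + j%:Z + 1 <= n + j.+1%:Z by lia.
have n0 : n <= n + 0%:Z by [].
pose b := fix b (j : nat) : Mc (n + j%:Z) k :=
  match j with
  | 0%N => zmap n0 k a
  | j.+1 => zmap (nSj j) k (zmap (le_next (n + j%:Z)) k (b j) + w (exist _ (n + j%:Z) (nj j)))
  end.
have nz (z : up_set n) : n + `|sval z - n|%N%:Z <= sval z by case: z => z /=; lia.
pose y (z : up_set n) : Mc (sval z) k := zmap (nz z) k (b `|sval z - n|%N).
have yE (z : up_set n) (j : nat) (jz : n + j%:Z <= sval z) :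
    sval z = n + j%:Z -> y z = zmap jz k (b j).
  move=> zj; have zj' : `|sval z - n|%N = j by lia.
  rewrite /y; move: (nz z); rewrite zj' => jz'; congr (cmap _ _ _).
  by congr (fmap M _); exact: (@Prop_irrelevance (_ <= sval z)).
exists y; split.
  have n0' : n + 0%:Z <= n by rewrite addr0.
  by rewrite (yE (up_start n) 0%N n0') ?addr0 //= (zmapM _ _ (lexx n)) zmap1.
move=> [z nz']; have [j zj] : exists j : nat, z = n + j%:Z by exists `|z - n|%N; lia.
move: nz'; rewrite zj => nz' {z zj}.
have Sj : n + j.+1%:Z <= n + j%:Z + 1 by lia.
rewrite (yE (up_next (exist _ (n + j%:Z) nz')) j.+1 Sj) /=; last by lia.
rewrite (yE (exist _ (n + j%:Z) nz') j (lexx _)) // zmap1.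
by rewrite (zmapM _ _ (lexx _)) zmap1 (Prop_irrelevance nz' (nj j)).
Qed.

Lemma up_set_ind n (P : up_set n -> Prop) :
  P (up_start n) -> (forall z, P z -> P (up_next z)) -> forall z, P z.
Proof.
move=> P0 PS [z nz]; have [j zj] : exists j : nat, z = n + j%:Z by exists `|z - n|%N; lia.
elim: j z zj nz => [|j IHj] z zj nz.
  have nn : z = n by rewrite zj addr0.
  by move: nz; rewrite nn => nz; rewrite (Prop_irrelevance nz (lexx n)).
have nz' : n <= z - 1 by lia.
have := PS _ (IHj (z - 1) _ nz'); rewrite /up_next /=.
move: (le_trans _ _); rewrite subrK => nz'' Pz; rewrite (Prop_irrelevance nz nz'').
by apply: Pz; lia.
Qed.

Lemma cast_degreeK (X : cochain K) (i j : int) (e : i = j) (x : X j) :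
  cast_degree X e (cast_degree X (esym e) x) = x.
Proof. by case: j / e x. Qed.

Lemma cast_degree_inj (X : cochain K) (i j : int) (e : i = j) : injective (cast_degree X e).
Proof. by case: j / e. Qed.

Lemma res_extend_cancel (V : zmodType) (p q t n u : V) :
  p = u + t -> p - (q + (t - (n - (u - q)))) = n.
Proof.
have -> : q + (t - (n - (u - q))) = u + t - n.
  by rewrite opprB addrCA [q + _]addrA [q + (u - q)]addrC subrK addrA (addrC t).
by move=> ->; rewrite subKr.
Qed.

Section Lifting.
Variables (n i j k : int) (ij : i + 1 = j) (jk : j + 1 = k) (p' : res_obj n j).
Hypothesis p'_cocycle : res_diff n jk p' = 0.

Lemma res_cocycle_y (z : up_set n) :
  cdiff _ (res_deg3 jk) (res_y j z p') = cast_degree _ (res_deg1 jk)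
    (zmap (svalP z) j (res_x n j p') - s _ j (hmap (svalP z) j (res_c n j p'))).
Proof.
have := congr1 (res_y k z) p'_cocycle; rewrite linear0 => E.
by apply/eqP; rewrite eq_sym -subr_eq0; apply/eqP.
Qed.

(** This is the [y] equation at [z = n]: the initial homotopy of a cocycle exhibits its [x] and the
    representative of its [c] as cohomologous. *)
Lemma res_cocycle_start :
  cdiff (Mc n) ij (cast_degree _ (esym (res_deg1 ij)) (res_y j (up_start n) p')) =
  res_x n j p' - s n j (res_c n j p').
Proof.
apply: (@cast_degree_inj _ _ _ (res_deg1 jk)).
have := res_cocycle_y (up_start n); rewrite zmap1 hmap1 => <-.
by rewrite -(cast_degree_diff ij (res_deg3 jk) (res_deg1 ij)) cast_degreeK.
Qed.

(** Only the [y] equation at [z = n] has to be arranged. With all [w] components of the lift set to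
    zero, the [w] equation at [z] determines [y] at the next index from [y z]. *)
Lemma res_extend (x0 : Mc n i) (c0 : H n i) (a0 : Mc n (i - 1)) :
  res_c n j p' = 0 -> cdiff (Mc n) ij x0 = res_x n j p' ->
  cast_degree _ (res_deg1 ij) (x0 - s n i c0) - cdiff _ (res_deg3 ij) a0 =
    res_y j (up_start n) p' ->
  exists p : res_obj n i, [/\ res_diff n ij p = p', res_x n i p = x0 & res_c n i p = c0].
Proof.
move=> c'0 dx0 ya0.
pose w' z := cast_degree _ (esym (res_deg2 ij)) (res_w j z p').
have [y [y0 yS]] := up_recursion a0 (fun z => h _ i (hmap (svalP z) i c0) - w' z).
have dw' z : cdiff _ (res_deg3 ij) (w' z) =
    res_y j (up_next z) p' - zmap (le_next (sval z)) (j - 1) (res_y j z p').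
  have E : cast_degree _ (res_deg2 jk)
      (zmap (le_next (sval z)) (j - 1) (res_y j z p') - res_y j (up_next z) p'
       + h _ j (hmap (svalP z) j (res_c n j p')))
      + cdiff _ (res_deg4 jk) (res_w j z p') = 0.
    by have := congr1 (res_w k z) p'_cocycle; rewrite linear0.
  apply: (@cast_degree_inj _ _ _ (res_deg2 jk)).
  rewrite -(cast_degree_diff _ (res_deg4 jk) (res_deg2 ij)) cast_degreeK.
  move: E; rewrite c'0 !linear0 addr0 => /eqP; rewrite addr_eq0 -eqr_oppLR => /eqP <-.
  by rewrite -linearN opprB.
have yE z : cast_degree _ (res_deg1 ij)
    (zmap (svalP z) i x0 - s _ i (hmap (svalP z) i c0)) - cdiff _ (res_deg3 ij) (y z) =
    res_y j z p'.
  (* The [y] equation propagates from [z] to its successor because [p'] is a cocycle: [dw'] gives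
     the coboundary of the prescribed [w] component, and [h_diff] that of the correction by [h]. *)
  move: z; apply: up_set_ind => [|z IHz]; first by rewrite zmap1 hmap1 y0.
  have dE : cdiff _ (res_deg3 ij) (zmap (le_next (sval z)) (i - 1) (y z)
        + (h _ i (hmap (svalP z) i c0) - w' z)) =
      zmap (le_next (sval z)) (j - 1) (cdiff _ (res_deg3 ij) (y z))
      + (cast_degree _ (res_deg1 ij)
          (zmap (le_next (sval z)) i (s _ i (hmap (svalP z) i c0))
           - s _ i (hmap (le_next (sval z)) i (hmap (svalP z) i c0)))
        - (res_y j (up_next z) p' - zmap (le_next (sval z)) (j - 1) (res_y j z p'))).
    by rewrite linearD linearB dw' h_diff -cmap_diff.
  rewrite yS; apply: etrans (congr1 (fun t => _ - t) dE) _.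
  rewrite -IHz [zmap _ _ (_ - _)]linearB cast_degree_map.
  apply: res_extend_cancel; rewrite -linearD [zmap _ _ (_ - _)]linearB addrA subrK.
  by rewrite (zmapM _ _ (svalP (up_next z))) (hmapM _ _ (svalP (up_next z))).
exists (x0, c0, y, fun z => 0); split=> //.
apply: res_ext => [||z|z]; [exact: dx0|by rewrite c'0|exact: yE|].
rewrite -[LHS]/(cast_degree _ (res_deg2 ij)
  (zmap (le_next (sval z)) (i - 1) (y z) - y (up_next z) + h _ i (hmap (svalP z) i c0))
  + cdiff _ (res_deg4 ij) 0).
rewrite linear0 addr0 yS opprD opprB addrA subrr add0r subrK; exact: cast_degreeK.
Qed.

End Lifting.

Definition resolution_fst : nattrans resolution M.
Proof.
exists (fun n : int => @CochainMap K (res_complex n) (Mc n) (res_x n)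
  (fun i j ij p => erefl) : @hom (Ch K) (resolution n) (M n)).
by move=> n n' nn'; apply: cochain_map_ext.
Defined.

Definition cohomology_complex : functor int_poset (Ch K) :=
  graded (fun k => functor_comp (cohomology_functor K k) M).

Definition resolution_snd_map (n : int) :
  cochain_map (res_complex n) (cohomology_complex n) :=
  @CochainMap K (res_complex n) (cohomology_complex n) (res_c n) (fun i j ij p => erefl).

Definition resolution_snd : nattrans resolution cohomology_complex.
Proof.
exists (resolution_snd_map : forall n : int_poset, hom (resolution n) _).
by move=> n n' nn'; apply: cochain_map_ext.
Defined.

(** Since [v] bounds the difference of [x'] and the representative of [c'], and [x0] bounds [x'],
    that representative is a coboundary and [c'] vanishes. Then [x0 - v] is a cocycle; its class is
    [c0], and [a0] bounds its distance from the representative of [c0]. *)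
Lemma resolution_fst_trivial_fibration : pointwise_trivial_fibration resolution_fst.
Proof.
move=> n i j k ij jk p' x0 p'_cocycle /= x'x0.
have dv := res_cocycle_start ij p'_cocycle.
set v : Mc n i := cast_degree _ (esym (res_deg1 ij)) (res_y j (up_start n) p') in dv.
have c'0 : res_c n j p' = 0.
  apply: (@cohomology_section_inj _ _ _ _ (@sP n j) _
    (cast_degree _ (res_deg1 ij) (x0 - v))).
  rewrite (cast_degree_diff ij _ _ erefl) /= linearB dv.
  by rewrite -[cdiff _ _ x0]x'x0 subKr.
have [|c0 [a0 da0]] := @cohomology_section_surj _ _ _ _ (@sP n i) j ij (x0 - v).
  by rewrite linearB dv c'0 linear0 subr0 -[cdiff _ _ x0]x'x0 subrr.
have [||p [pp' px pc]] := @res_extend n i j k ij jk p' p'_cocycle x0 c0 a0 c'0.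
- by rewrite -[LHS]x'x0.
- rewrite (cast_degree_diff (subrK 1 i) _ erefl (res_deg1 ij)) da0 -linearB.
  by rewrite opprB subrKA subKr /v cast_degreeK.
by exists p.
Qed.

(** The target has zero differential, so [c'] vanishes at once. Taking [v + s n i c0] for [x] and
    zero for the initial homotopy solves the [y] equation at [z = n]. *)
Lemma resolution_snd_trivial_fibration : pointwise_trivial_fibration resolution_snd.
Proof.
move=> n i j k ij jk p' c0 p'_cocycle c'0.
have dv := res_cocycle_start ij p'_cocycle.
set v : Mc n i := cast_degree _ (esym (res_deg1 ij)) (res_y j (up_start n) p') in dv.
have [|||p [pp' px pc]] := @res_extend n i j k ij jk p' p'_cocycle (v + s n i c0) c0 0.
- exact: c'0.
- rewrite linearD dv (cohomology_section_cocycle (@sP n i)) addr0.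
  by rewrite -[res_c n j p']/(res_c n j p') [res_c n j p']c'0 linear0 subr0.
- by rewrite addrK linear0 subr0 /v cast_degreeK.
by exists p.
Qed.

End Formality.

Lemma pers_complex_formal (K : fieldType) (M : functor int_poset (Ch K)) :
  exists (P : functor int_poset (Ch K)) (p : nattrans P M)
    (q : nattrans P (cohomology_complex M)),
    pointwise_trivial_fibration p /\ pointwise_trivial_fibration q.
Proof.
have [s sP] : exists s : forall n k : int,
    {linear cohomology (M n : cochain K) k -> (M n : cochain K) k},
    forall n k, cohomology_section_of (s n k).
  pose S n k := cid (cohomology_section_exists (M n : cochain K) k).
  by exists (fun n k => sval (S n k)) => n k; exact: svalP (S n k).
pose T n k := cid (cohomology_section_nat (@sP n k) (zmap M (le_next n)) (@sP (n + 1) k)).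
pose h n k := sval (T n k).
have hP n k c : cdiff (M (n + 1) : cochain K) (subrK 1 k) (h n k c) =
    zmap M (le_next n) k (s n k c) - s (n + 1) k (hmap M (le_next n) k c).
  exact: svalP (T n k) c.
exists (resolution sP hP), (resolution_fst sP hP), (resolution_snd sP hP); split.
  exact: resolution_fst_trivial_fibration.
exact: resolution_snd_trivial_fibration.
Qed.

(** * Interleavings in homotopy categories *)

Definition functor_id (C : category) : functor C C :=
  Functor (fun X => erefl (idc X)) (fun X Y Z g f => erefl (comp g f)).

Lemma shift_unit_nat (R : realType) (C : category) (e : {nonneg R}) (X Y : pers R C)
    (f : hom X Y) :
  comp (shift_unit e Y) f =
  comp (fmap (shift C e%:num) (fmap (shift C e%:num) f)) (shift_unit e X).
Proof. by apply: nattrans_ext => a; symmetry; exact: (ntnat f). Qed.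

Section HoFunctors.
Variables (C D : category).
Variables (V : forall X Y : C, hom X Y -> Prop) (W : forall X Y : D, hom X Y -> Prop).

Lemma ho_functor_nat (E E' : functor C D)
    (EVW : forall X Y (f : hom X Y), V f -> W (fmap E f))
    (EVW' : forall X Y (f : hom X Y), V f -> W (fmap E' f))
    (eta : forall X, hom (E X) (E' X)) :
  (forall X Y (f : hom X Y), comp (eta Y) (fmap E f) = comp (fmap E' f) (eta X)) ->
  forall (X Y : Ho V) (f : hom X Y),
    comp (fmap (to_ho W) (eta Y)) (fmap (ho_functor EVW) f) =
    comp (fmap (ho_functor EVW') f) (fmap (to_ho W) (eta X)).
Proof.
move=> nat; apply: (@ho_natural _ _ (Ho W) (ho_functor EVW) (ho_functor EVW')
  (fun X => fmap (to_ho W) (eta X))) => X Y f.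
by rewrite !ho_functorE -[LHS](fmapM (to_ho W)) -[RHS](fmapM (to_ho W)) nat.
Qed.

End HoFunctors.

Section HoInterleaved.
Variables (C : category) (W : forall X Y : C, hom X Y -> Prop).
Variables (S : functor C C) (SW : forall X Y (f : hom X Y), W f -> W (fmap S f)).
Variable s : forall X : C, hom X (S (S X)).
Hypothesis snat : forall (X Y : C) (f : hom X Y),
  comp (s Y) f = comp (fmap S (fmap S f)) (s X).

Lemma ho_unit_nat (X Y : Ho W) (f : hom X Y) :
  comp (fmap (to_ho W) (s Y)) f =
  comp (fmap (ho_functor SW) (fmap (ho_functor SW) f)) (fmap (to_ho W) (s X)).
Proof.
move: X Y f; apply: (@ho_natural _ _ (Ho W) (functor_id _)
  (functor_comp (ho_functor SW) (ho_functor SW)) (fun X => fmap (to_ho W) (s X))) => X Y f.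
change (comp (fmap (to_ho W) (s Y)) (fmap (to_ho W) f) =
  comp (fmap (ho_functor SW) (fmap (ho_functor SW) (fmap (to_ho W) f)))
    (fmap (to_ho W) (s X))).
by rewrite !ho_functorE -[LHS](fmapM (to_ho W)) snat -[RHS](fmapM (to_ho W)).
Qed.

Lemma ho_interleaved_by (X X' Y Y' : C) :
  weakly_equivalent W X X' -> weakly_equivalent W Y Y' -> interleaved_by s X' Y' ->
  @interleaved_by (Ho W) (ho_functor SW) (fun Z => fmap (to_ho W) (s Z)) X Y.
Proof.
move=> XX' YY' [phi [psi [E1 E2]]].
apply: (@interleaved_by_iso (Ho W) (ho_functor SW) _ ho_unit_nat X X' Y Y').
- exact: weakly_equivalent_isomorphic XX'.
- exact: weakly_equivalent_isomorphic YY'.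
exists (fmap (to_ho W) phi), (fmap (to_ho W) psi); split; rewrite ho_functorE.
  by rewrite -E1 [RHS](fmapM (to_ho W)).
by rewrite -E2 [RHS](fmapM (to_ho W)).
Qed.

(** Applied with [E] and [E'] the evaluations at a and at a + e, and [eta] the identity. Induced
    functors act through chosen representatives of classes, so the composite of two of them is
    compared with a third by naturality and not by computation. *)
Lemma interleaved_by_ho_evaluation (D : category) (V : forall X Y : D, hom X Y -> Prop)
    (E E' : functor C D) (EWV : forall X Y (f : hom X Y), W f -> V _ _ (fmap E f))
    (EWV' : forall X Y (f : hom X Y), W f -> V _ _ (fmap E' f))
    (eta : forall X, hom (E (S X)) (E' X)) (X Y : Ho W) (f : @hom (Ho W) X (ho_functor SW Y))
    (g : @hom (Ho W) Y (ho_functor SW X)) :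
  (forall X Y (f : hom X Y),
     comp (eta Y) (fmap E (fmap S f)) = comp (fmap E' f) (eta X)) ->
  comp (fmap (ho_functor SW) g) f = fmap (to_ho W) (s X) ->
  @comp (Ho V) _ _ _ (fmap (ho_functor EWV') g)
    (comp (fmap (to_ho V) (eta Y)) (fmap (ho_functor EWV) f)) =
  fmap (to_ho V) (comp (eta (S X)) (fmap E (s X))).
Proof.
move=> nat gf.
have natH : forall (X0 Y0 : Ho W) (f0 : hom X0 Y0),
    @comp (Ho V) _ _ _ (fmap (to_ho V) (eta Y0))
      (fmap (ho_functor EWV) (fmap (ho_functor SW) f0)) =
    comp (fmap (ho_functor EWV') f0) (fmap (to_ho V) (eta X0)).
  apply: (@ho_natural _ _ (Ho V) (functor_comp (ho_functor EWV) (ho_functor SW))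
    (ho_functor EWV') (fun X => fmap (to_ho V) (eta X))) => X0 Y0 f0.
  rewrite -[fmap (functor_comp _ _) _]/(fmap (ho_functor EWV) (fmap (ho_functor SW)
    (fmap (to_ho W) f0))).
  by rewrite !ho_functorE -[LHS](fmapM (to_ho V)) -[RHS](fmapM (to_ho V)) nat.
rewrite compA -[X in comp X _]natH -compA -[X in comp _ X](fmapM (ho_functor EWV)) gf.
by rewrite ho_functorE [RHS](fmapM (to_ho V)).
Qed.

End HoInterleaved.

(** * From the homotopy category of diagrams to diagrams in the homotopy category *)

Section PersistentHo.
Variables (R : realType) (C : category) (W : forall X Y : C, hom X Y -> Prop).
Implicit Types X Y Z : pers R C.

Definition pointwise X Y (f : hom X Y) : Prop := forall r : R, W (ntapp f r).

(* A parameter, because [ho_functor] depends on this proof term. *)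
Variable shift_pointwise : forall (e : R) X Y (f : hom X Y),
  pointwise f -> pointwise (fmap (shift C e) f).

Definition evaluation (r : R) : functor (pers R C) C.
Proof.
by exists (fun X : pers R C => X r) (fun X Y (f : nattrans X Y) => f (r : real_poset R)).
Defined.

Lemma evaluation_pointwise (r : R) X Y (f : hom X Y) :
  pointwise f -> W (fmap (evaluation r) f).
Proof. exact. Qed.

Local Notation HoPers := (Ho pointwise).
Local Notation to_ho_pers := (to_ho pointwise).
Local Notation hshift e := (ho_functor (@shift_pointwise e)).
Local Notation heval a := (ho_functor (@evaluation_pointwise a)).

(** The structure maps from a to b form a transformation between two evaluation functors; being
    natural on diagrams, it stays natural after localization. *)
Lemma ho_evaluation_nat (a b : R) (ab : a <= b) (X Y : HoPers) (f : hom X Y) :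
  @comp (Ho W) _ _ _ (fmap (to_ho W) (pmap (Y : pers R C) ab)) (fmap (heval a) f) =
  comp (fmap (heval b) f) (fmap (to_ho W) (pmap (X : pers R C) ab)).
Proof.
apply: (@ho_functor_nat (pers R C) C pointwise W _ _ (@evaluation_pointwise a)
  (@evaluation_pointwise b) (fun X : pers R C => pmap X ab)) => X0 Y0 f0.
by symmetry; exact: pmap_nat.
Qed.

Lemma ho_evaluation_unit (e : {nonneg R}) (a : R) (X Y : HoPers)
    (f : @hom HoPers X (hshift e%:num Y)) (g : @hom HoPers Y (hshift e%:num X)) :
  comp (fmap (hshift e%:num) g) f = fmap to_ho_pers (shift_unit e X) ->
  @comp (Ho W) _ _ _ (fmap (heval (a + e%:num)) g) (fmap (heval a) f) =
  fmap (to_ho W) (pmap (X : pers R C) (shift_unit_subproof e a)).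
Proof.
move=> gf.
have := @interleaved_by_ho_evaluation (pers R C) pointwise _
  (@shift_pointwise e%:num) (shift_unit e) C W (evaluation a) (evaluation (a + e%:num))
  (@evaluation_pointwise a) (@evaluation_pointwise (a + e%:num))
  (fun X : pers R C => idc (X (a + e%:num))) X Y f g _ gf.
rewrite !fmap1 !comp1c; apply=> X0 Y0 f0.
by rewrite comp1c compc1.
Qed.

Lemma ho_evaluation_nattrans (e : R) (X Y : HoPers) (f : @hom HoPers X (hshift e Y)) :
  exists phi : nattrans (functor_comp (to_ho W) X)
      (shift (Ho W) e (functor_comp (to_ho W) Y : pers R (Ho W))),
    forall a : R, phi a = fmap (heval a) f.
Proof.
unshelve eexists.
  exists (fun a : real_poset R => fmap (heval a) f) => a b ab.
  symmetry; exact: (@ho_evaluation_nat a b ab X (hshift e Y) f).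
by [].
Qed.

Lemma interleaved_ho_evaluation (e : {nonneg R}) X Y :
  @interleaved_by HoPers (hshift e%:num) (fun Z => fmap to_ho_pers (shift_unit e Z)) X Y ->
  @interleaved R (Ho W) e (functor_comp (to_ho W) X) (functor_comp (to_ho W) Y).
Proof.
move=> [f [g [E1 E2]]].
have [phi phiE] := ho_evaluation_nattrans f.
have [psi psiE] := ho_evaluation_nattrans g.
exists phi, psi; split; apply: nattrans_ext => a.
  rewrite -[LHS]/(comp (psi (a + e%:num)) (phi a)) phiE psiE.
  exact: ho_evaluation_unit E1.
rewrite -[LHS]/(comp (phi (a + e%:num)) (psi a)) phiE psiE.
exact: ho_evaluation_unit E2.
Qed.

End PersistentHo.

Section Comparison.
Variables (K : fieldType) (R : realType).
Implicit Types X Y Z : pers R (Ch K).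

Lemma homotopy_interleaved_ho (e : {nonneg R}) X Y :
  homotopy_interleaved e X Y -> ho_interleaved e X Y.
Proof.
move=> [X' [Y' [XX' YY' XY']]].
exact: (@ho_interleaved_by _ _ _ (@shift_quasi_iso K R e%:num) (shift_unit e)
  (@shift_unit_nat R (Ch K) e) X X' Y Y' XX' YY' XY').
Qed.

Lemma ho_interleaved_homotopy_commutative (e : {nonneg R}) X Y :
  ho_interleaved e X Y -> homotopy_commutative_interleaved e X Y.
Proof.
move=> XY.
by refine (@interleaved_ho_evaluation R (Ch K) (@quasi_iso K) (@shift_quasi_iso K R)
  e X Y XY).
Qed.

Lemma cohomology_inverse (k : int) (X Y : Ch K) (f : hom X Y) (qf : quasi_iso f) :
  exists g : {linear cohomology Y k -> cohomology X k},
    cancel (cohomology_map f k) g /\ cancel g (cohomology_map f k).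
Proof.
have [g fK gK] := qf k.
have gl : linear g by apply: can2_linear fK gK.
by exists (mk_linear gl).
Qed.

Definition ho_cohomology (k : int) : functor (HoCh K) (vect K).
Proof.
pose inv (X Y : Ch K) (f : hom X Y) (qf : quasi_iso f) : @hom (vect K) _ _ :=
  sval (cid (cohomology_inverse k qf)).
apply: (@ho_lift _ _ (vect K) (cohomology_functor K k) inv) => X Y f qf.
  by apply: linear_ext => x; rewrite /inv; case: cid => g [fK gK] /=; exact: fK.
by apply: linear_ext => x; rewrite /inv; case: cid => g [fK gK] /=; exact: gK.
Defined.

(** Cohomology inverts quasi-isomorphisms, hence factors through [HoCh], and every functor preserves
    interleavings. *)
Lemma homotopy_commutative_interleaved_cohomology (e : {nonneg R}) (k : int) X Y :
  homotopy_commutative_interleaved e X Y ->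
  interleaved e (functor_comp (cohomology_functor K k) X : pers R (vect K))
                (functor_comp (cohomology_functor K k) Y : pers R (vect K)).
Proof.
move=> /interleavedP/(soft_interleaved_fmap (ho_cohomology k)) XY; apply/interleavedP.
have E X0 : functor_comp (ho_cohomology k) (functor_comp (to_ho _) X0) =
    functor_comp (cohomology_functor K k) X0 :> functor (real_poset R) (vect K).
  by apply: functor_ext => a b ab; rewrite /ho_cohomology ho_liftE.
by rewrite -!E.
Qed.

End Comparison.

(** * Discretization *)

(** All the maps involved are structure maps of [F]: for [a + d <= b] one has both [a <= g b] and
    [g a <= b]. *)
Lemma soft_interleaved_reindex (R : realType) (C : category) (F : pers R C)
    (g : functor (real_poset R) (real_poset R)) (d : R) :
  0 <= d -> (forall a : R, a <= g a) -> (forall a : R, (g a : R) <= a + d) ->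
  soft_interleaved d F (functor_comp F g : pers R C).
Proof.
move=> d_ge0 ag ga.
have ab1 (a b : R) : a + d <= b -> a <= (g b : R).
  by move=> ab; rewrite (le_trans _ (ag b))// (le_trans _ ab)// lerDl.
have ab2 (a b : R) : a + d <= b -> (g a : R) <= b.
  by move=> ab; rewrite (le_trans (ga a)).
have gg (a b : R) (ab : a <= b) : (g a : R) <= g b := fmap g (ab : @hom (real_poset R) a b).
have gE (a b : R) (ab : a <= b) : pmap (functor_comp F g : pers R C) ab = pmap F (gg a b ab).
  congr (fmap F _); exact: (@Prop_irrelevance ((g a : R) <= g b)).
have [f fE] : exists f : shift_map d F (functor_comp F g : pers R C),
    forall a b ab, f a b ab = pmap F (ab1 a b ab).
  unshelve eexists.
    exists (fun (a b : R) ab => pmap F (ab1 a b ab)) => a a' b b' aa' a'b bb' ab'.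
    rewrite gE (pmapM F _ _ (le_trans aa' (ab1 _ _ a'b))).
    exact: pmapM.
  by [].
have [h hE] : exists h : shift_map d (functor_comp F g : pers R C) F,
    forall a b ab, h a b ab = pmap F (ab2 a b ab).
  unshelve eexists.
    exists (fun (a b : R) ab => pmap F (ab2 a b ab)) => a a' b b' aa' a'b bb' ab'.
    rewrite gE (pmapM F _ _ (le_trans (gg _ _ aa') (ab2 _ _ a'b))).
    exact: (@pmapM R C F (g a) b b').
  by [].
exists f, h; split=> a b c ab bc ac; rewrite fE hE; first exact: pmapM.
by rewrite gE; exact: (@pmapM R C F (g a) b (g c)).
Qed.

(** With zero differentials, maps in different degrees need no compatibility, so interleavings
    chosen separately for each [k] assemble, provided that they share the same [e]. *)
Lemma soft_interleaved_graded (R : realType) (K : fieldType) (e : R)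
    (V W : int -> pers R (vect K)) :
  (forall k, soft_interleaved e (V k) (W k)) ->
  soft_interleaved e (graded V : pers R (Ch K)) (graded W : pers R (Ch K)).
Proof.
have mk (V' W' : int -> pers R (vect K)) (f : forall k, shift_map e (V' k) (W' k)) :
    exists f' : shift_map e (graded V' : pers R (Ch K)) (graded W' : pers R (Ch K)),
    forall a b ab k x, (f' a b ab : cochain_map _ _) k x = (f k a b ab : {linear _ -> _}) x.
  unshelve eexists.
    exists (fun (a b : R) ab =>
      @CochainMap K (graded_complex V' a) (graded_complex W' b) (fun k => f k a b ab)
        (fun i j ij x => linear0 (f j a b ab))) => a a' b b' aa' a'b bb' ab'.
    apply: cochain_map_ext => k x.
    by have /(congr1 (fun t : {linear _ -> _} => t x)) := smap_nat (f k) aa' a'b bb' ab'.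
  by [].
move=> VW.
pose f k := cid (VW k); pose g k := cid (svalP (f k)).
have [f' f'E] := mk _ _ (fun k => sval (f k)).
have [g' g'E] := mk _ _ (fun k => sval (g k)).
exists f', g'; split=> a b c ab bc ac; apply: cochain_map_ext => k x /=.
  rewrite g'E f'E; have [+ _] := svalP (g k) => /(_ a b c ab bc ac).
  by move=> /(congr1 (fun t : {linear _ -> _} => t x)).
rewrite g'E f'E; have [_ +] := svalP (g k) => /(_ a b c ab bc ac).
by move=> /(congr1 (fun t : {linear _ -> _} => t x)).
Qed.

Lemma functor_compA (C D E F : category) (h : functor E F) (g : functor D E)
    (f : functor C D) :
  functor_comp h (functor_comp g f) = functor_comp (functor_comp h g) f.
Proof. exact: functor_ext. Qed.

Lemma graded_reindex (K : fieldType) (I J : category) (V : int -> functor J (vect K))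
    (f : functor I J) :
  functor_comp (graded V) f = graded (fun k => functor_comp (V k) f).
Proof. by apply: functor_ext => a b ab; exact: cochain_map_ext. Qed.

Section Grid.
Variables (R : realType) (d : R).
Hypothesis d_gt0 : 0 < d.

Fact grid_homo (a b : int) : a <= b -> a%:~R * d <= b%:~R * d.
Proof. by move=> ab; rewrite ler_pM2r // ler_int. Qed.

Definition grid : functor int_poset (real_poset R).
Proof.
exists (fun z : int => z%:~R * d : real_poset R) grid_homo.
all: by move=> *; exact: (@Prop_irrelevance (_ <= _ :> R)).
Defined.

Fact grid_ceil_homo (a b : R) : a <= b -> Num.ceil (a / d) <= Num.ceil (b / d).
Proof. by move=> ab; rewrite le_ceil // ler_pM2r // invr_gt0. Qed.

Definition grid_ceil : functor (real_poset R) int_poset.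
Proof.
exists (fun r : R => Num.ceil (r / d) : int_poset) grid_ceil_homo.
all: by move=> *; exact: (@Prop_irrelevance (_ <= _ :> int)).
Defined.

Lemma le_grid (a : R) : a <= (functor_comp grid grid_ceil a : R).
Proof. by rewrite /= -ler_pdivrMr // ceil_ge. Qed.

Lemma grid_le (a : R) : (functor_comp grid grid_ceil a : R) <= a + d.
Proof.
rewrite /= -[X in _ <= X + _](divfK (lt0r_neq0 d_gt0)) -[X in _ <= _ + X]mul1r -mulrDl.
by rewrite ler_pM2r // ltW // -ltrBlDr; have := ceilB1_lt (a / d); rewrite intrB.
Qed.

End Grid.

Section Discretization.
Variables (K : fieldType) (R : realType) (d : R).
Hypothesis d_gt0 : 0 < d.
Implicit Types X Y : pers R (Ch K).

Let rnd := functor_comp (grid d_gt0) (grid_ceil d_gt0).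
Let HX X (k : int) : pers R (vect K) := functor_comp (cohomology_functor K k) X.

(** The rounding factors through the integers, so the span given by formality of [M] can be
    restricted along [grid_ceil]. This costs nothing; the whole [d] comes from replacing [X] by its
    rounding. *)
Lemma span_interleaved_cohomology X :
  span_interleaved d X (graded (fun k => functor_comp (HX X k) rnd) : pers R (Ch K)).
Proof.
pose M : functor int_poset (Ch K) := functor_comp X (grid d_gt0).
pose DX : pers R (Ch K) := functor_comp X rnd.
have XD : soft_interleaved d X DX.
  apply: soft_interleaved_reindex; first exact: ltW.
    exact: (le_grid d_gt0).
  exact: (grid_le d_gt0).
have [P [p [q [tp tq]]]] := pers_complex_formal M.
pose P' : pers R (Ch K) := functor_comp P (grid_ceil d_gt0).
have pE : functor_comp M (grid_ceil d_gt0) = DX by rewrite /DX functor_compA.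
have qE : functor_comp (cohomology_complex M) (grid_ceil d_gt0) =
    graded (fun k => functor_comp (HX X k) rnd) :> functor (real_poset R) (Ch K).
  rewrite graded_reindex; congr graded; apply/funext => k.
  by rewrite /HX /rnd !functor_compA.
pose p' := fmap (precompose (Ch K) (grid_ceil d_gt0)) (p : @hom (functor_category _ _) P M).
pose q' := fmap (precompose (Ch K) (grid_ceil d_gt0))
  (q : @hom (functor_category _ _) P (cohomology_complex M)).
rewrite -qE; rewrite -pE in XD.
have d0 : d + 0 <= d by rewrite addr0.
apply: (@span_interleaved_trans K R d 0 d X (functor_comp M (grid_ceil d_gt0)) _
  (ltW d_gt0) (lexx 0) d0 (soft_interleaved_span_interleaved XD)).
exists P', P', p', q'; split.
- by move=> a; exact: tp.
- by move=> a; exact: tq.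
- exact: soft_interleaved_refl.
Qed.

(** Of the four [d], two link [X] and [Y] to their rounded cohomologies, and two undo and redo the
    rounding around the given interleavings of cohomology. *)
Lemma span_interleaved_of_cohomology e X Y : 0 <= e ->
  (forall k, soft_interleaved e (HX X k) (HX Y k)) ->
  span_interleaved (4 * d + e) X Y.
Proof.
move=> e_ge0 XY; have d_ge0 := ltW d_gt0.
have rounded k : soft_interleaved (d + e + d) (functor_comp (HX X k) rnd : pers R (vect K))
    (functor_comp (HX Y k) rnd : pers R (vect K)).
  have rE Z : soft_interleaved d (HX Z k) (functor_comp (HX Z k) rnd : pers R (vect K)).
    apply: soft_interleaved_reindex => //; [exact: (le_grid d_gt0)|exact: (grid_le d_gt0)].
  apply: (soft_interleaved_trans (addr_ge0 d_ge0 e_ge0) d_ge0 (lexx _) _ (rE Y)).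
  exact: soft_interleaved_trans d_ge0 e_ge0 (lexx _) (soft_interleaved_sym (rE X)) (XY k).
have HXY := soft_interleaved_span_interleaved (soft_interleaved_graded rounded).
have de_ge0 : 0 <= d + e + d by rewrite !addr_ge0.
have := span_interleaved_trans d_ge0 de_ge0 (lexx _) (span_interleaved_cohomology X) HXY.
move=> XHY; apply: (span_interleaved_trans (addr_ge0 d_ge0 de_ge0) d_ge0 _ XHY).
  by lra.
exact/span_interleaved_sym/span_interleaved_cohomology.
Qed.

End Discretization.

(** * Comparison of the four distances *)

Lemma dHI_le_dCohI (K : fieldType) (R : realType) (X Y : pers R (Ch K)) :
  (dHI X Y <= dCohI X Y)%E.
Proof.
have dk k : (dI (functor_comp (cohomology_functor K k) X : pers R (vect K))
    (functor_comp (cohomology_functor K k) Y : pers R (vect K)) <= dCohI X Y)%E.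
  by apply: ereal_sup_ubound; exists k.
have dCohI_ge0 : (0 <= dCohI X Y)%E := le_trans (inf_dist_ge0 _) (dk 0).
case E : (dCohI X Y) dk dCohI_ge0 => [c| |] dk c_ge0; [|exact: leey|by []].
apply/lee_addgt0Pr => h h_gt0; rewrite lee_fin in c_ge0.
(* Five shares of [h]: four for the discretization, and one because the supremum [c] need not be
   attained, so that interleavings are only available strictly above it. *)
have d_gt0 : 0 < h / 5 by rewrite divr_gt0.
have XY k : soft_interleaved (c + h / 5)
    (functor_comp (cohomology_functor K k) X : pers R (vect K))
    (functor_comp (cohomology_functor K k) Y : pers R (vect K)).
  have : (dI (functor_comp (cohomology_functor K k) X : pers R (vect K))
    (functor_comp (cohomology_functor K k) Y : pers R (vect K)) < (c + h / 5)%:E)%E.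
    by apply: le_lt_trans (dk k) _; rewrite lte_fin ltrDl.
  move=> /inf_dist_lt[e /interleavedP XYe ec].
  by apply: soft_interleaved_le (ltW ec) XYe.
have ch_ge0 : 0 <= c + h by rewrite addr_ge0 // ltW.
have := span_interleaved_of_cohomology d_gt0 (addr_ge0 c_ge0 (ltW d_gt0)) XY.
rewrite (_ : 4 * (h / 5) + (c + h / 5) = (NngNum ch_ge0)%:num); last first.
  by rewrite /=; lra.
move=> /span_interleaved_homotopy XYh.
exact: (@inf_dist_lb R (fun e => homotopy_interleaved e X Y) _ XYh).
Qed.

Lemma dCohI_le_dHC (K : fieldType) (R : realType) (X Y : pers R (Ch K)) :
  (dCohI X Y <= dHC X Y)%E.
Proof.
apply: ge_ereal_sup => _ [k _ <-]; apply: inf_dist_le => e.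
exact: homotopy_commutative_interleaved_cohomology.
Qed.

Theorem theorem3p3 (K : fieldType) (R : realType) (X Y : pers R (Ch K)) :
  dHC X Y = dIHC X Y /\ dIHC X Y = dHI X Y /\ dHI X Y = dCohI X Y.
Proof.
have CH := dCohI_le_dHC X Y; have HC := dHI_le_dCohI X Y.
have HI : (dHC X Y <= dIHC X Y)%E.
  by apply: inf_dist_le => e; exact: ho_interleaved_homotopy_commutative.
have IH : (dIHC X Y <= dHI X Y)%E.
  by apply: inf_dist_le => e; exact: homotopy_interleaved_ho.
split; last split; apply/eqP; rewrite eq_le.
- by rewrite HI (le_trans IH (le_trans HC CH)).
- by rewrite IH (le_trans HC (le_trans CH HI)).
- by rewrite HC (le_trans CH (le_trans HI IH)).
Qed.
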